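(* For any integers $k>d\ge 1$ with $(k,d)\neq(2,1)$, there are no $k$ to $d$ cubical cut and project sets which are $\mathrm{LR}$ with respect to $\mathcal{C}_d$, where $\mathcal{C}_d$ is the collection of convex polytopes in $\mathbb{R}^d$ with non-empty interior and all vertices in $\mathbb{Z}^d$.
   Context: **Cut and project sets.** Let $k>d\ge1$ be integers and $e_1,\dots,e_k$ the standard basis of $\mathbb{R}^k$. Let $E\subseteq\mathbb{R}^k$ be a $d$-dimensional subspace, $F_\pi\subseteq\mathbb{R}^k$ a subspace complementary to $E$, and $\pi:\mathbb{R}^k\to E$ the projection with respect to $\mathbb{R}^k=E+F_\pi$; it is assumed that $\pi|_{\mathbb{Z}^k}$ is injective. For a set (window) $\mathcal{W}_\pi\subseteq F_\pi$ put $\mathcal{S}=\mathcal{W}_\pi+E$ (the strip). For $s\in\mathbb{R}^k/\mathbb{Z}^k$, the set $Y=Y_s=\pi(\mathcal{S}\cap(\mathbb{Z}^k+s))\subseteq E$ is called a $k$ to $d$ cut and project set. It is regular if $(\mathbb{Z}^k+s)\cap\partial\mathcal{S}=\emptyset$. $E$ is totally irrational if its canonical projection to $\mathbb{R}^k/\mathbb{Z}^k$ is dense. $Y$ is aperiodic if the only $x\in E$ with $Y+x=Y$ is $x=0$. Let $F_\rho=\{0\}\times\mathbb{R}^{k-d}$; it is assumed that $E$ is complementary to $F_\rho$ (so $E$ is the graph of a linear map $\mathbb{R}^d\to\mathbb{R}^{k-d}$). Let $\rho:\mathbb{R}^k\to E$ be the projection with respect to $\mathbb{R}^k=E+F_\rho$.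 Put $\mathcal{W}=\mathcal{S}\cap F_\rho$ (also called the window; $\mathcal{S}=\mathcal{W}+E$). The window is cubical if $\mathcal{W}=\{\sum_{i=d+1}^k t_ie_i:0\le t_i<1\}$. A cubical cut and project set is a regular, totally irrational (meaning $E$ is totally irrational), aperiodic cut and project set with cubical window. **Patterns.** Subsets of $\mathbb{R}^d$ are regarded as subsets of $\langle e_1,\dots,e_d\rangle_{\mathbb{R}}\subseteq\mathbb{R}^k$, and as subsets of $E$ via $\rho$. For $y\in Y$, $\tilde y\in\mathbb{Z}^k$ is the unique point with $\pi(\tilde y+s)=y$. For bounded $\Omega\subseteq\mathbb{R}^d$ and $y\in Y$, the patch of shape $\Omega$ at $y$ is $P(y,\Omega)=\{y'\in Y:\rho(\tilde y'-\tilde y)\in\rho(\Omega)\}$. Patches $P(y_1,\Omega)$ and $P(y_2,\Omega)$ are equivalent if $P(y_1,\Omega)=P(y_2,\Omega)+y_1-y_2$; a pattern of shape $\Omega$ is an equivalence class of patches. A pattern of shape $\Omega$ occurs in a region $R\subseteq\mathbb{R}^d$ if there is $y\in Y\cap\rho(R)$ such that $P(y,\Omega)$ belongs to that class. **LR.** For a collection $\mathcal{A}$ of bounded measurable subsets of $\mathbb{R}^d$, $Y$ is LR with respect to $\mathcal{A}$ if there is a constant $C>0$ such that for every $\Omega\in\mathcal{A}$, every pattern of shape $\Omega$ in $Y$ occurs in every ball of volume $C|\Omega|$ in $\mathbb{R}^d$, where $|\Omega|$ is the $d$-dimensional Lebesgue measure of $\Omega$. *)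

(* Defs.v *)
From HB Require Import structures.
From mathcomp Require Import all_boot all_order all_algebra.
From mathcomp Require Import all_classical all_reals all_analysis.

Set Implicit Arguments.
Unset Strict Implicit.
Unset Printing Implicit Defensive.

Import Order.TTheory GRing.Theory Num.Theory.
Import numFieldNormedType.Exports.

Local Open Scope classical_set_scope.
Local Open Scope ring_scope.
Local Open Scope quotient_scope.

(* The iterated product of the Lebesgue measure of the line, on the product
   sigma-algebra of R^n; see lebesgue_tuple_measure and vol_box below. *)
Fixpoint lebesgue_tuple (R : realType) (n : nat) :
    set (n.-tuple (measurableTypeR R)) -> \bar R :=
  match n with
  | 0 => dirac [tuple]
  | m.+1 => pushforward (lebesgue_measure \x @lebesgue_tuple R m)%E
              (fun p => [tuple of p.1 :: p.2])
  end.

Definition vol (R : realType) (d : nat) (A : set 'rV[R]_d) : \bar R :=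
  lebesgue_tuple [set t : d.-tuple (measurableTypeR R) |
                   A (\row_i tnth t i)].

Section LebesgueTuple.
Variable R : realType.
Notation RT := (measurableTypeR R).

Lemma sigma_finite_measure_pack d (T : measurableType d)
    (mu : {measure set T -> \bar R}) : sigma_finite setT mu ->
  exists nu : {sigma_finite_measure set T -> \bar R},
    mu = nu :> (set T -> \bar R).
Proof.
move=> mufin.
pose H1 := isSFinite.Build _ _ _ _ (sfinite_measure_sigma_finite mufin).
pose H2 := isSigmaFinite.Build _ _ _ _ mufin.
by exists (HB.pack_for (SigmaFiniteMeasure.type T R) (Measure.sort mu) H1 H2).
Qed.

Lemma product_sigma_finite d1 d2 (T1 : measurableType d1)
    (T2 : measurableType d2) (m1 : {sigma_finite_measure set T1 -> \bar R})
    (m2 : {sigma_finite_measure set T2 -> \bar R}) :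
  sigma_finite setT (m1 \x m2)%E.
Proof.
have /sigma_finiteP[F [TF ndF Foo]] := sigma_finiteT m1.
have /sigma_finiteP[G [TG ndG Goo]] := sigma_finiteT m2.
exists (fun n => F n `*` G n).
  rewrite -setXTT TF TG; apply/seteqP; split => -[x y] /=; last first.
    by move=> [n _ []/= ? ?]; split; exists n.
  move=> [[n _ Fnx] [k _ Gky]]; exists (maxn n k) => //; split.
  - by move: x Fnx; exact/subsetPset/ndF/leq_maxl.
  - by move: y Gky; exact/subsetPset/ndG/leq_maxr.
move=> k; have [? ?] := Foo k; have [? ?] := Goo k.
split; first exact: measurableX.
by rewrite product_measure1E// lte_mul_pinfty// ge0_fin_numE.
Qed.

Lemma lebesgue_tuple_measure (n : nat) :
  exists mu : {sigma_finite_measure set (n.-tuple RT) -> \bar R},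
    lebesgue_tuple (n := n) = mu.
Proof.
elim: n => [|n [mu IH]]; first by exists (dirac ([tuple] : 0.-tuple RT)).
pose consT (p : RT * n.-tuple RT) : n.+1.-tuple RT := [tuple of p.1 :: p.2].
have mcons : measurable_fun [set: _] consT.
  exact: (measurable_cons measurable_fst measurable_snd).
pose hdtl (t : n.+1.-tuple RT) : RT * n.-tuple RT :=
  (tnth t ord0, [tuple of behead t]).
have hdtlK : cancel hdtl consT.
  by move=> t; rewrite [RHS]tuple_eta; apply: val_inj.
have consK : cancel consT hdtl.
  by move=> [x t]; congr pair; exact: val_inj.
have mhdtl : measurable_fun [set: _] hdtl.
  apply/measurable_fun_pairP; split; first exact: measurable_tnth.
  exact: measurable_behead.
pose m := (lebesgue_measure \x mu)%E.
pose nu : {measure set (n.+1.-tuple RT) -> \bar R} := pushforward m consT.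
have [F FT Ffin] :=
  product_sigma_finite (lebesgue_measure : {sigma_finite_measure set RT -> \bar R}) mu.
have nufin : sigma_finite setT (nu mcons).
  exists (fun i => hdtl @^-1` F i).
    by rewrite -preimage_bigcup -FT preimage_setT.
  move=> i; have [mF mFoo] := Ffin i; split.
    by rewrite -[X in measurable X]setTI; exact: mhdtl.
  rewrite /nu /= /pushforward -comp_preimage.
  by rewrite (_ : hdtl \o consT = id)//; apply/funext => p /=; rewrite consK.
have [mu' mu'E] := sigma_finite_measure_pack nufin.
by exists mu'; rewrite -mu'E /= IH.
Qed.

Lemma lebesgue_tuple_box (n : nat) (I : 'I_n -> set RT) :
  (forall i, measurable (I i)) ->
  lebesgue_tuple [set t : n.-tuple RT | forall i, I i (tnth t i)] =
  (\prod_(i < n) lebesgue_measure (I i))%E.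
Proof.
elim: n I => [|n IH] I mI.
  by rewrite big_ord0 /= diracE mem_set//= => -[].
rewrite /= /pushforward big_ord_recl.
have [mu muE] := lebesgue_tuple_measure n.
rewrite -IH// muE -product_measure1E//; last first.
  rewrite (_ : [set t | _] =
    \bigcap_(i in [set: 'I_n]) (@tnth n RT ^~ i @^-1` I (lift ord0 i))).
    apply: fin_bigcap_measurable => // i _.
    by rewrite -[X in measurable X]setTI; exact: measurable_tnth.
  by apply/seteqP; split => t /= H i; [move=> _|]; exact: H.
congr (product_measure1 _ _ _); apply/seteqP; split => -[x t] /=.
  by move=> H; split => [|i]; [exact: (H ord0)|have := H (lift ord0 i); rewrite tnthS].
move=> [Hx Ht] i; have [j ->|->//] := unliftP ord0 i; by rewrite tnthS.
Qed.

Lemma vol_box (d : nat) (a b : 'rV[R]_d) : (forall i, a 0 i <= b 0 i) ->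
  vol [set x : 'rV[R]_d | forall i, a 0 i <= x 0 i <= b 0 i] =
  (\prod_(i < d) (b 0 i - a 0 i))%:E.
Proof.
move=> ab; rewrite /vol.
pose I (i : 'I_d) : set RT := [set` `[a 0 i, b 0 i]].
rewrite (_ : [set t | _] = [set t : d.-tuple RT | forall i, I i (tnth t i)]).
  rewrite lebesgue_tuple_box => [|i]; last exact: measurable_itv.
  rewrite -prodEFin; apply: eq_bigr => i _.
  rewrite lebesgue_measure_itv/= lte_fin; case: ltP => //.
  by move=> ba; rewrite (@le_anti _ _ (a 0 i) (b 0 i)) ?ab ?ba// subrr.
by apply/seteqP; split => t /= H i; have := H i; rewrite /I /= in_itv /= mxE.
Qed.

End LebesgueTuple.

Section Torus.
Variables (R : realType) (k : nat).

Definition Zlat : set 'rV[R]_k := [set n | n \is a mxOver Num.int].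

Definition torus_rel (x y : 'rV[R]_k) : bool := (x - y) \is a mxOver Num.int.

Let torus_relP (x y : 'rV[R]_k) :
  reflect (forall i, x 0 i - y 0 i \is a Num.int) (torus_rel x y).
Proof.
apply: (iffP mxOverP) => [H i|H i j]; first by have := H 0 i; rewrite !mxE.
by rewrite (ord1 i) !mxE.
Qed.

Let torus_refl : reflexive torus_rel.
Proof. by move=> x; apply/torus_relP => i; rewrite subrr rpred0. Qed.

Let torus_sym : symmetric torus_rel.
Proof.
by move=> x y; apply/torus_relP/torus_relP => H i; rewrite -rpredN opprB.
Qed.

Let torus_trans : transitive torus_rel.
Proof.
move=> y x z /torus_relP xy /torus_relP yz; apply/torus_relP => i.
by rewrite -(subrKA (y 0 i)) rpredD.
Qed.

Definition torus_equiv := EquivRel torus_rel torus_refl torus_sym torus_trans.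

(* R^k / Z^k with the quotient topology. *)
Definition torus : topologicalType := quotient_topology {eq_quot torus_equiv}.

Definition to_torus (x : 'rV[R]_k) : torus := \pi_({eq_quot torus_equiv}) x.

End Torus.

Section CutAndProject.
Variables (R : realType) (k d : nat).
Notation V := 'rV[R]_k.

Definition complementary (U W : {vspace V}) : Prop :=
  (U + W)%VS = fullv /\ (U :&: W)%VS = 0%VS.

Definition Frho : {vspace V} :=
  <<[seq (delta_mx 0%R i : V) | i : 'I_k <- enum 'I_k & (d <= i)%N]>>%VS.

Definition embed (x : 'rV[R]_d) : V :=
  \row_(j < k) oapp (fun i : 'I_d => x 0 i) 0 (insub (val j)).

(* The class s in R^k / Z^k is given by a representative cp_shift: both the
   set cp_set and the differences of the points cp_lift below only depend on
   the class. *)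
Record cp_data := CPData {
  cp_E : {vspace V};
  cp_Fpi : {vspace V};
  cp_Wpi : set V;
  cp_shift : V;
  cp_dimE : \dim cp_E = d;
  cp_compl_pi : complementary cp_E cp_Fpi;
  cp_compl_rho : complementary cp_E Frho;
  cp_Wpi_sub : cp_Wpi `<=` [set x | x \in cp_Fpi];
  cp_inj : {in @Zlat R k &, injective (daddv_pi cp_E cp_Fpi)}
}.

Variable c : cp_data.

(* daddv_pi U W is the projection onto U along W. *)
Definition cp_pi : V -> V := daddv_pi (cp_E c) (cp_Fpi c).
Definition cp_rho : V -> V := daddv_pi (cp_E c) Frho.

Definition strip : set V :=
  [set w + e | w in cp_Wpi c & e in [set e | e \in cp_E c]].

Definition shifted_lattice : set V := [set n + cp_shift c | n in @Zlat R k].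

Definition cp_set : set V := cp_pi @` (strip `&` shifted_lattice).

Definition boundary (A : set V) : set V := closure A `\` interior A.

Definition regular : Prop := shifted_lattice `&` boundary strip = set0.

Definition totally_irrational : Prop :=
  dense (@to_torus R k @` [set x | x \in cp_E c]).

Definition aperiodic : Prop :=
  forall x, x \in cp_E c -> [set y + x | y in cp_set] = cp_set -> x = 0.

Definition cubical_window : Prop :=
  strip `&` [set x | x \in Frho] =
  [set \sum_(i < k | (d <= i)%N) t i *: delta_mx 0 i |
     t in [set t : 'I_k -> R | forall i, 0 <= t i < 1]].

Definition cubical_cp_set : Prop :=
  [/\ regular, totally_irrational, aperiodic & cubical_window].

(* The point written y~ : the unique n in Z^k with pi (n + s) = y
   (unique by cp_inj; 0 if there is none, which does not occur on cp_set). *)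
Definition cp_lift (y : V) : V :=
  xget 0 [set n | Zlat n /\ cp_pi (n + cp_shift c) = y].

(* Subsets of R^d regarded as subsets of E. *)
Definition in_E (A : set 'rV[R]_d) : set V := cp_rho @` (embed @` A).

Definition patch (y : V) (Omega : set 'rV[R]_d) : set V :=
  [set y' | cp_set y' /\ in_E Omega (cp_rho (cp_lift y' - cp_lift y))].

Definition patch_equiv (Omega : set 'rV[R]_d) (y1 y2 : V) : Prop :=
  patch y1 Omega = [set z + y1 - y2 | z in patch y2 Omega].

(* Equivalence of patches involves their base points, so a pattern is
   represented by the set of base points y in Y of the patches P(y, Omega) in
   the class. *)
Definition is_pattern (Omega : set 'rV[R]_d) (p : set V) : Prop :=
  exists2 y, cp_set y & p = [set y' | cp_set y' /\ patch_equiv Omega y y'].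

Definition occurs_in (p : set V) (A : set 'rV[R]_d) : Prop :=
  exists2 y, (cp_set `&` in_E A) y & p y.

Definition eball (x : 'rV[R]_d) (r : R) : set 'rV[R]_d :=
  [set y | Num.sqrt (\sum_(i < d) (y 0 i - x 0 i) ^+ 2) < r].

(* Applied to collections of bounded measurable sets only. *)
Definition is_LR (A : set (set 'rV[R]_d)) : Prop :=
  exists2 C : R, 0 < C & forall Omega, A Omega ->
    forall p, is_pattern Omega p ->
    forall x r, 0 < r -> vol (eball x r) = (C%:E * vol Omega)%E ->
    occurs_in p (eball x r).

End CutAndProject.

Section Polytopes.
Variables (R : realType) (d : nat).

Definition convex_hull (A : set 'rV[R]_d) : set 'rV[R]_d :=
  smallest (@convex_set R 'rV[R]_d) A.

Definition convex_polytope (P : set 'rV[R]_d) : Prop :=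
  exists s : seq 'rV[R]_d, P = convex_hull [set` s].

(* The vertices of a polytope are its extreme points. *)
Definition vertex (P : set 'rV[R]_d) (v : 'rV[R]_d) : Prop :=
  P v /\ forall x y (t : R), P x -> P y -> 0 < t < 1 ->
    v = t *: x + (1 - t) *: y -> x = v /\ y = v.

Definition lattice_polytopes : set (set 'rV[R]_d) :=
  [set P | [/\ convex_polytope P, interior P !=set0 &
             forall v, vertex P v -> Zlat v]].

End Polytopes.

(* Main.v *)
(** Since the window is cubical, a point of the cut and project set is a lattice
    point [z] whose star coordinates [star (z + s) i], [d <= i], all lie in
    [0, 1); by regularity they are nonzero. The patch of shape [Omega] at [z]
    knows, for each lattice point [m] of [Omega], on which side of the fractional
    part of [- star m i] each star coordinate lies, and by total irrationality
    every cell of the resulting subdivision of the unit cube is visited.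

    If [d >= 2], some [star e_p i] is irrational, so the simplices with vertices
    [0], [e_q + a e_p] and the other [e_j] (all of volume at most 6) have cells of
    arbitrarily small width [star (z + s) i < theta]. Linear repetitivity makes
    all of them occur in one fixed ball around the origin, which contains finitely
    many points, each with a positive star coordinate: a contradiction.

    If [d = 1] and [k >= 3], the segment [0, N] has at least [N ^ 2] patterns, as
    two star coordinates are each cut into [N] cells, while a ball of volume
    proportional to [N] contains [O(N)] points. *)

Require Import Defs.
From mathcomp Require Import all_boot all_order all_algebra.
From mathcomp Require Import all_classical all_reals all_analysis.
From mathcomp Require Import measurable_realfun.
From mathcomp Require Import lra ring zify.

Set Implicit Arguments.
Unset Strict Implicit.
Unset Printing Implicit Defensive.

Import Order.TTheory GRing.Theory Num.Theory.
Import numFieldNormedType.Exports.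

Local Open Scope classical_set_scope.
Local Open Scope ring_scope.

(** * Convex hulls and simplices *)

Section ConvexHull.
Variables (R : realType) (d : nat).
Implicit Types (A : set 'rV[R]_d) (x y v : 'rV[R]_d).

Lemma convex_setE (A : set 'rV[R]_d) :
  @convex_set R 'rV[R]_d A <->
  forall x y (t : R), 0 <= t <= 1 -> A x -> A y -> A (t *: x + (1 - t) *: y).
Proof.
split=> [cA x y t /andP[t0 t1] Ax Ay|cA x y t xA yA].
  have t01 : Itv.spec (@Itv.num_sem R) (Itv.Real `[Posz 0, Posz 1]) t.
    by rewrite /Itv.num_sem /= ger0_real // in_itv /= t0 t1.
  by have := cA x y (Itv.mk t01); rewrite !inE; apply.
move: xA yA; rewrite !inE => xA yA.
by apply: cA => //; rewrite ge0 le1.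
Qed.

Lemma sub_convex_hull A : A `<=` convex_hull A.
Proof. exact: sub_smallest. Qed.

Lemma convex_convex_hull A x y (t : R) : 0 <= t <= 1 ->
  convex_hull A x -> convex_hull A y -> convex_hull A (t *: x + (1 - t) *: y).
Proof.
move=> t01 Ax Ay B [/[dup] cB /convex_setE cB' AB].
by apply: cB' => //; [exact: Ax|exact: Ay].
Qed.

Lemma convex_hull_sub A B :
  (forall x y (t : R), 0 <= t <= 1 -> B x -> B y ->
    B (t *: x + (1 - t) *: y)) ->
  A `<=` B -> convex_hull A `<=` B.
Proof. by move=> cB AB; apply: smallest_sub => //; exact/convex_setE. Qed.

(** If the extreme point [v] were not in [A], the hull with [v] removed would still be convex and
    contain [A], hence would contain the whole hull. *)
Lemma vertex_convex_hull A v : vertex (convex_hull A) v -> A v.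
Proof.
move=> [Hv vP]; apply: contrapT => nAv.
have := @convex_hull_sub A (convex_hull A `\ v).
move=> H; suff [_ /(_ erefl)] : (convex_hull A `\ v) v by [].
apply: H => //; last first.
  by move=> x Ax; split; [exact: sub_convex_hull|move=> xv; apply: nAv; rewrite -xv].
move=> x y t t01 [Ax xv] [Ay yv]; split; first exact: convex_convex_hull.
move=> /= vE; move: t01 => /andP[]; rewrite !le_eqVlt => /orP[/eqP t0 _|t0].
  by apply: yv; rewrite /= -vE -t0 scale0r add0r subr0 scale1r.
move=> /orP[/eqP t1|t1].
  by apply: xv; rewrite /= -vE t1 scale1r subrr scale0r addr0.
by have [] := vP x y t Ax Ay _ (esym vE); rewrite ?t0 ?t1.
Qed.

(** The point 0 takes the missing weight, so the weights need not sum to 1. The induction splits off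
    one term and rescales the others by [1 - l i]. *)
Lemma convex_hull_sum (A : set 'rV[R]_d) (I : eqType) (s : seq I)
    (l : I -> R) (v : I -> 'rV[R]_d) :
  A 0 -> (forall i, A (v i)) -> (forall i, 0 <= l i) -> \sum_(i <- s) l i <= 1 ->
  convex_hull A (\sum_(i <- s) l i *: v i).
Proof.
move=> A0 Av; elim: s l => [|i s IH] l l0.
  by rewrite !big_nil => _; apply: sub_convex_hull.
rewrite !big_cons => l1.
have sl0 : 0 <= \sum_(j <- s) l j by exact: sumr_ge0.
have [li1|li1] := eqVneq (l i) 1.
  have s0 : \sum_(j <- s) l j = 0.
    by apply/eqP; rewrite eq_le sl0 andbT -(lerD2l 1) addr0 -{1}li1.
  rewrite li1 scale1r big_seq big1 ?addr0; first by apply: sub_convex_hull; exact: Av.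
  move=> j js; move/eqP: s0; rewrite psumr_eq0// => /allP/(_ _ js)/eqP ->.
  by rewrite scale0r.
have li1' : 0 < 1 - l i.
  by rewrite subr_gt0 lt_neqAle li1 (le_trans _ l1)// lerDl.
rewrite (_ : \sum_(j <- s) l j *: v j =
             (1 - l i) *: \sum_(j <- s) (l j / (1 - l i)) *: v j); last first.
  rewrite scaler_sumr; apply: eq_bigr => j _.
  by rewrite scalerA mulrC divfK// gt_eqF.
apply: convex_convex_hull; first by rewrite l0 /= -subr_ge0 ltW.
  by apply: sub_convex_hull; exact: Av.
apply: IH => [j|]; first by rewrite divr_ge0// ltW.
by rewrite -mulr_suml ler_pdivrMr// mul1r lerBrDl.
Qed.

(** The vertices are 0 and the rows of [B]. Describing the simplex by coordinates in this basis
    turns measurability and volume bounds into linear inequalities. *)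
Definition simplex (B : 'M[R]_d) : set 'rV[R]_d :=
  [set x | (forall i, 0 <= (x *m invmx B) 0 i) /\
           \sum_i (x *m invmx B) 0 i <= 1].

Lemma simplexE (B : 'M[R]_d) : B \in unitmx ->
  simplex B = convex_hull [set` 0 :: [seq row i B | i <- enum 'I_d]].
Proof.
move=> uB; apply/seteqP; split => x.
  move=> [x0 x1]; rewrite -[x](mulmxKV uB) mulmx_sum_row.
  have -> : \sum_i (x *m invmx B) 0 i *: row i B =
            \sum_(i <- enum 'I_d) (x *m invmx B) 0 i *: row i B by rewrite big_enum.
  apply: convex_hull_sum => //=; last by rewrite big_enum.
    by rewrite inE eqxx.
  by move=> i; rewrite inE (map_f (fun j => row j B)) ?orbT ?mem_enum.
apply: convex_hull_sub => {x} [x y t /andP[t0 t1] [x0 x1] [y0 y1]|x /=].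
  have E i : ((t *: x + (1 - t) *: y) *m invmx B) 0 i =
     t * (x *m invmx B) 0 i + (1 - t) * (y *m invmx B) 0 i.
    by rewrite mulmxDl -!scalemxAl !mxE.
  split=> [i|]; first by rewrite E addr_ge0// mulr_ge0// subr_ge0.
  rewrite (eq_bigr _ (fun i _ => E i)) big_split /= -!mulr_sumr.
  rewrite -[leRHS](subrKC t) lerD// ler_piMr// subr_ge0//.
rewrite inE => /orP[/eqP ->|/mapP[i _ ->]].
  rewrite /simplex /= mul0mx; split; first by move=> i; rewrite mxE.
  by rewrite big1// => i _; rewrite mxE.
rewrite /simplex /= -row_mul mulmxV//; split=> [j|].
  by rewrite !mxE; case: eqP.
rewrite (bigD1 i)//= big1 => [|j ji]; first by rewrite !mxE eqxx addr0.
by rewrite !mxE eq_sym (negbTE ji).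
Qed.

Lemma simplex_row (B : 'M[R]_d) i : B \in unitmx -> simplex B (row i B).
Proof.
move=> uB; rewrite simplexE//; apply: sub_convex_hull => /=.
by rewrite inE (map_f (fun j => row j B)) ?orbT ?mem_enum.
Qed.

End ConvexHull.

(** * Volume *)

Section Volume.
Variables (R : realType) (d : nat).
Notation RT := (measurableTypeR R).
Implicit Types (A B : set 'rV[R]_d).

Definition vol_measurable A :=
  measurable [set t : d.-tuple RT | A (\row_i tnth t i)].

Lemma le_vol A B : vol_measurable A -> vol_measurable B -> A `<=` B ->
  (vol A <= vol B)%E.
Proof.
move=> mA mB AB; rewrite /vol; have [mu ->] := lebesgue_tuple_measure R d.
by apply: le_measure; rewrite ?inE// => t; exact: AB.
Qed.

Lemma vol_ge0 A : (0 <= vol A)%E.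
Proof.
by rewrite /vol; have [mu ->] := lebesgue_tuple_measure R d.
Qed.

Lemma vol_setU0 A B : vol_measurable A -> vol_measurable B -> vol B = 0%E ->
  vol (A `|` B) = vol A.
Proof.
rewrite /vol /vol_measurable; have [mu ->] := lebesgue_tuple_measure R d.
move=> mA mB B0.
by rewrite -[RHS](measureU0 mA mB B0).
Qed.

Lemma vol_bigsetU_le (F : nat -> set 'rV[R]_d) n :
  (forall i, vol_measurable (F i)) ->
  (vol [set x | exists2 i, (i < n)%N & F i x] <= \sum_(i < n) vol (F i))%E.
Proof.
rewrite /vol /vol_measurable; have [mu ->] := lebesgue_tuple_measure R d.
move=> mF; pose G i := [set t : d.-tuple RT | F i (\row_j tnth t j)].
apply: le_trans (@Boole_inequality _ _ _ mu G n (fun i _ => mF i)).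
apply: le_measure; rewrite ?inE.
- rewrite (_ : [set t | _] =
    \big[setU/set0]_(i < n) G i).
    by apply: bigsetU_measurable => i _; exact: mF.
  by rewrite -bigcup_mkord; apply/seteqP; split => t [i ? ?]; exists i.
- by apply: bigsetU_measurable => i _; exact: mF.
- by rewrite -bigcup_mkord => t [i ? ?]; exists i.
Qed.

Lemma vol_nondecreasing_cvg (F : nat -> set 'rV[R]_d) :
  (forall i, vol_measurable (F i)) -> {homo F : m n / (m <= n)%N >-> m `<=` n} ->
  vol (F n) @[n --> \oo] --> vol (\bigcup_n F n).
Proof.
rewrite /vol /vol_measurable; have [mu ->] := lebesgue_tuple_measure R d.
move=> mF homoF.
have -> : [set t : d.-tuple RT | (\bigcup_n F n) (\row_i tnth t i)] =
    \bigcup_n [set t : d.-tuple RT | F n (\row_i tnth t i)] by [].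
apply: (@nondecreasing_cvg_mu _ _ _ mu
  (fun n => [set t : d.-tuple RT | F n (\row_i tnth t i)])) => //.
  exact: bigcup_measurable.
by move=> m n mn; apply/subsetPset => t; exact: homoF.
Qed.

Lemma vol_nonincreasing_cvg (F : nat -> set 'rV[R]_d) :
  (vol (F 0%N) < +oo)%E ->
  (forall i, vol_measurable (F i)) -> {homo F : m n / (m <= n)%N >-> n `<=` m} ->
  vol (F n) @[n --> \oo] --> vol (\bigcap_n F n).
Proof.
rewrite /vol /vol_measurable; have [mu ->] := lebesgue_tuple_measure R d.
move=> F0 mF homoF.
have -> : [set t : d.-tuple RT | (\bigcap_n F n) (\row_i tnth t i)] =
    \bigcap_n [set t : d.-tuple RT | F n (\row_i tnth t i)] by [].
apply: (@nonincreasing_cvg_mu _ _ _ mu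
  (fun n => [set t : d.-tuple RT | F n (\row_i tnth t i)])) => //.
  exact: bigcap_measurable.
by move=> m n mn; apply/subsetPset => t; exact: homoF.
Qed.

Definition coord_measurable (f : 'rV[R]_d -> R) :=
  measurable_fun [set: d.-tuple RT] (fun t => f (\row_i tnth t i) : RT).

Lemma coord_measurable_coord i : coord_measurable (fun x => x 0 i).
Proof.
rewrite /coord_measurable.
by under eq_fun do rewrite mxE; exact: measurable_tnth.
Qed.

Lemma coord_measurable_cst (r : R) : coord_measurable (fun=> r).
Proof. exact: measurable_cst. Qed.

Lemma vol_measurable_le f g : coord_measurable f -> coord_measurable g ->
  vol_measurable [set x | f x <= g x].
Proof.
move=> mf mg; have := measurable_fun_ler mf mg => /(_ measurableT [set true]).
by rewrite setTI; exact.
Qed.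

Lemma vol_measurable_lt f g : coord_measurable f -> coord_measurable g ->
  vol_measurable [set x | f x < g x].
Proof.
move=> mf mg; have := measurable_fun_ltr mf mg => /(_ measurableT [set true]).
by rewrite setTI; exact.
Qed.

Lemma vol_measurableI A B : vol_measurable A -> vol_measurable B ->
  vol_measurable (A `&` B).
Proof. exact: measurableI. Qed.

Lemma vol_measurable_forall (I : finType) (F : I -> set 'rV[R]_d) :
  (forall i, vol_measurable (F i)) -> vol_measurable [set x | forall i, F i x].
Proof.
move=> mF; rewrite /vol_measurable.
rewrite (_ : [set t | _] =
  \bigcap_(i in [set: I]) [set t : d.-tuple RT | F i (\row_j tnth t j)]).
  by apply: fin_bigcap_measurable => // i _; exact: mF.
by apply/seteqP; split => t H i; [move=> _|]; exact: H.
Qed.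

Definition box (a b : 'rV[R]_d) := [set x : 'rV[R]_d | forall i, a 0 i <= x 0 i <= b 0 i].

Lemma vol_measurable_box (a b : 'rV[R]_d) : vol_measurable (box a b).
Proof.
apply: (vol_measurable_forall
  (F := fun i => [set x | a 0 i <= x 0 i <= b 0 i])) => i.
rewrite (_ : [set x | _] = [set x | a 0 i <= x 0 i] `&` [set x | x 0 i <= b 0 i]).
  apply: vol_measurableI; apply: vol_measurable_le;
    first [exact: coord_measurable_cst | exact: coord_measurable_coord].
by apply/seteqP; split => x /=; [move/andP|move=> ?; exact/andP].
Qed.

Definition qball (rho : R) := [set x : 'rV[R]_d | \sum_i x 0 i ^+ 2 < rho].
Definition qcball (rho : R) := [set x : 'rV[R]_d | \sum_i x 0 i ^+ 2 <= rho].

Lemma coord_measurable_sqr : coord_measurable (fun x => \sum_i x 0 i ^+ 2).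
Proof.
rewrite /coord_measurable.
apply: (@measurable_sum _ (d.-tuple RT) R setT _ _
  (fun i t => (\row_j tnth t j) 0 i ^+ 2)) => i.
by apply: measurable_funX; exact: coord_measurable_coord.
Qed.

Lemma vol_measurable_qball rho : vol_measurable (qball rho).
Proof.
apply: vol_measurable_lt; first exact: coord_measurable_sqr.
exact: coord_measurable_cst.
Qed.

Lemma vol_measurable_qcball rho : vol_measurable (qcball rho).
Proof.
apply: vol_measurable_le; first exact: coord_measurable_sqr.
exact: coord_measurable_cst.
Qed.

End Volume.

(* Each section of the sphere in the first coordinate has at most two points. *)
Lemma vol_sphere (R : realType) (d : nat) (rho : R) :
  vol [set x : 'rV[R]_d.+1 | \sum_i x 0 i ^+ 2 = rho] = 0%E.
Proof.
pose RT := measurableTypeR R.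
rewrite /vol /= /pushforward; have [mu ->] := lebesgue_tuple_measure R d.
set X := (X in product_measure1 _ _ X).
have XE : X = [set p : RT * d.-tuple RT |
    p.1 ^+ 2 + \sum_i tnth p.2 i ^+ 2 = rho].
  suff E (p : RT * d.-tuple RT) :
      \sum_(i < d.+1) (\row_j tnth [tuple of p.1 :: p.2] j : 'rV[R]_d.+1) 0 i ^+ 2
      = p.1 ^+ 2 + \sum_i tnth p.2 i ^+ 2.
    by apply/seteqP; split => p; rewrite /X /= E.
  rewrite big_ord_recl mxE tnth0; congr (_ + _); apply: eq_bigr => i _.
  by rewrite mxE tnthS.
have mX : measurable X.
  have mf : measurable_fun setT (fun p : RT * d.-tuple RT =>
      p.1 ^+ 2 + \sum_i tnth p.2 i ^+ 2 : RT).
    apply: measurable_funD; first exact: measurable_funX.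
    apply: measurable_sum => i; apply: measurable_funX.
    apply: (@measurableT_comp _ _ _ _ _ _ (fun t : d.-tuple RT => tnth t i)).
      exact: measurable_tnth.
    exact: measurable_snd.
  by have := mf measurableT [set rho] (measurable_set1 rho); rewrite setTI XE.
(* By uniqueness of the product measure, the sections in the first coordinate may be measured
   first. *)
transitivity ((lebesgue_measure \x^ mu)%E X).
  by apply: product_measure_unique => // A B mA mB; exact: product_measure2E.
apply: integral0_eq => t _ /=.
apply: countable_lebesgue_measure0; apply: finite_set_countable.
apply: (@sub_finite_set _ _ [set` [:: Num.sqrt (rho - \sum_i tnth t i ^+ 2);
  - Num.sqrt (rho - \sum_i tnth t i ^+ 2)]]); last exact: finite_seq.
move=> x; rewrite XE /ysection /= inE /= => xE.
have -> : rho - \sum_i tnth t i ^+ 2 = x ^+ 2 by rewrite -xE addrK.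
rewrite sqrtr_sqr !inE; case: (ler0P x) => _; by rewrite ?opprK eqxx ?orbT.
Qed.

(** * Balls of prescribed volume *)

Section Balls.
Variables (R : realType) (d : nat).
Local Notation qball := (@qball R d.+1).
Local Notation qcball := (@qcball R d.+1).

Definition cube (a : R) : set 'rV[R]_d.+1 := box (const_mx (- a)) (const_mx a).

Lemma vol_cube a : 0 <= a -> vol (cube a) = ((a *+ 2) ^+ d.+1)%:E.
Proof.
move=> a0; rewrite vol_box => [|i]; last by rewrite !mxE; lra.
congr (_%:E); rewrite (eq_bigr (fun=> a *+ 2)) => [|i _]; last first.
  by rewrite !mxE opprK.
by rewrite big_const_ord iter_mulr_1.
Qed.

Lemma cube_sub_qball a rho : d.+1%:R * a ^+ 2 < rho -> cube a `<=` qball rho.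
Proof.
move=> arho x xa; apply: le_lt_trans arho.
rewrite mulr_natl -[X in _ *+ X]card_ord -sumr_const; apply: ler_sum => i _.
have := xa i; rewrite !mxE => /andP[x1 x2].
by rewrite -real_normK ?num_real// lerXn2r ?nnegrE// ?ler_norml ?x1 ?x2//; lra.
Qed.

(** A coordinate is at most 1 or at most its own square, whence a bound without square roots. *)
Lemma qball_sub_cube rho : qball rho `<=` cube (rho + 1).
Proof.
move=> x xrho i; rewrite !mxE -ler_norml.
have xi : x 0 i ^+ 2 < rho.
  apply: le_lt_trans xrho; rewrite (bigD1 i)//= lerDl sumr_ge0// => j _.
  exact: sqr_ge0.
have [x1|x1] := leP `|x 0 i| 1.
  by apply: (le_trans x1); rewrite lerDr (le_trans _ (ltW xi))// sqr_ge0.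
have : `|x 0 i| <= `|x 0 i| ^+ 2 by rewrite expr2 ler_peMl// ltW.
by rewrite real_normK ?num_real//; lra.
Qed.

Lemma vol_qball_lty rho : (vol (qball rho) < +oo)%E.
Proof.
apply: (@le_lt_trans _ _ (vol (cube `|rho + 1|))).
  apply: le_vol => //; [exact: vol_measurable_qball|exact: vol_measurable_box|].
  move=> x /qball_sub_cube xrho i; have := xrho i; rewrite !mxE => /andP[x1 x2].
  have := ler_norm (rho + 1); lra.
by rewrite vol_cube// ltry.
Qed.

Lemma vol_qcball rho : vol (qcball rho) = vol (qball rho).
Proof.
pose S := [set x : 'rV[R]_d.+1 | \sum_i x 0 i ^+ 2 = rho].
have SE : S = qcball rho `&` ~` qball rho.
  apply/seteqP; split => x; rewrite /S /qcball /qball /=.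
    by move=> ->; rewrite lexx ltxx.
  by move=> [x1 /negP]; rewrite -leNgt => x2; apply/eqP; rewrite eq_le x1.
have mS : vol_measurable S.
  rewrite SE; apply: vol_measurableI; first exact: vol_measurable_qcball.
  by apply: measurableC; exact: vol_measurable_qball.
have := vol_setU0 (vol_measurable_qball rho) mS (vol_sphere d rho) => <-.
congr vol; apply/seteqP; split => x; rewrite /S /qcball /qball /=.
  by rewrite le_eqVlt => /orP[/eqP|]; [right|left].
by move=> [/ltW|->].
Qed.

(** Left continuity of the volume: an open ball is the increasing union of the smaller ones. *)
Lemma vol_qball_left (v : \bar R) rho :
  (forall rho', rho' < rho -> (vol (qball rho') <= v)%E) ->
  (vol (qball rho) <= v)%E.
Proof.
move=> H; pose F n := qball (rho - n.+1%:R^-1).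
have mF n : vol_measurable (F n) by exact: vol_measurable_qball.
have ndF : {homo F : m n / (m <= n)%N >-> m `<=` n}.
  move=> m n mn x; rewrite /F /qball /= => /lt_le_trans; apply.
  by rewrite lerD2l lerN2 lef_pV2 ?posrE// ler_nat.
have := vol_nondecreasing_cvg mF ndF.
rewrite (_ : \bigcup_n F n = qball rho); last first.
  apply/seteqP; split => x /=.
    move=> [n _]; rewrite /F /qball /= => /lt_trans; apply.
    by rewrite ltrBlDr ltrDl invr_gt0.
  move=> xrho; have := xrho; rewrite /qball /= -subr_gt0 => x0.
  have [n nx] : exists n, n.+1%:R^-1 < rho - \sum_i x 0 i ^+ 2.
    by have [n _ /(_ n (leqnn n))] := near_infty_natSinv_lt (PosNum x0); exists n.
  by exists n => //; rewrite /F /qball /= ltrBrDr addrC -ltrBrDr.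
move=> cF; rewrite -(cvg_lim _ cF)//; apply: lime_le.
  by apply/cvg_ex; exists (vol (qball rho)).
by apply: nearW => n; apply: H; rewrite ltrBlDr ltrDl invr_gt0.
Qed.

(** Right continuity: the larger balls decrease to the closed ball, which has the volume of the open
    one because spheres are null. *)
Lemma vol_qball_right (v : \bar R) rho :
  (forall rho', rho < rho' -> (v <= vol (qball rho'))%E) ->
  (v <= vol (qball rho))%E.
Proof.
move=> H; pose F n := qball (rho + n.+1%:R^-1).
have mF n : vol_measurable (F n) by exact: vol_measurable_qball.
have niF : {homo F : m n / (m <= n)%N >-> n `<=` m}.
  move=> m n mn x; rewrite /F /qball /= => /lt_le_trans; apply.
  by rewrite lerD2l lef_pV2 ?posrE// ler_nat.
have := vol_nonincreasing_cvg (vol_qball_lty _) mF niF.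
rewrite (_ : \bigcap_n F n = qcball rho); last first.
  apply/seteqP; split => x /=.
    move=> xF; rewrite /qcball /= leNgt; apply/negP; rewrite -subr_gt0 => x0.
    have [n nx] : exists n, n.+1%:R^-1 < \sum_i x 0 i ^+ 2 - rho.
      by have [n _ /(_ n (leqnn n))] := near_infty_natSinv_lt (PosNum x0); exists n.
    by have := xF n I; rewrite /F /qball /= -ltrBlDl => /(lt_trans nx); rewrite ltxx.
  move=> xrho n _; apply: le_lt_trans xrho _.
  by rewrite ltrDl invr_gt0.
move=> cF; rewrite -vol_qcball -(cvg_lim _ cF)//; apply: lime_ge.
  by apply/cvg_ex; exists (vol (qcball rho)).
by apply: nearW => n; apply: H; rewrite ltrDl invr_gt0.
Qed.

Lemma vol_qball_large (v rho : R) : 0 <= v -> d.+1%:R * (v + 1) ^+ 2 < rho ->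
  (v%:E < vol (qball rho))%E.
Proof.
move=> v0 /cube_sub_qball vrho.
have := le_vol (vol_measurable_box _ _) (vol_measurable_qball _) vrho.
rewrite vol_cube ?addr_ge0//; apply: lt_le_trans; rewrite lte_fin exprS.
by rewrite (@lt_le_trans _ _ ((v + 1) *+ 2))// ?ler_peMr ?exprn_ege1//; lra.
Qed.

(** Linear repetitivity only speaks of balls of one exact volume, so such a ball must be produced.
    By one-sided continuity, the supremum of the [rho] with volume at most [v] gives volume [v]. *)
Lemma vol_qball_surj (v : R) : 0 < v ->
  exists2 rho, 0 < rho & vol (qball rho) = v%:E.
Proof.
move=> v0; pose S := [set rho : R | (vol (qball rho) <= v%:E)%E].
have vol0 rho : rho <= 0 -> vol (qball rho) = 0%E.
  move=> rho0; rewrite (_ : qball rho = set0).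
    by rewrite /vol; have [mu ->] := lebesgue_tuple_measure R d.+1; exact: measure0.
  apply/seteqP; split => x //=; rewrite /qball /= => /lt_le_trans/(_ rho0).
  by rewrite ltNge sumr_ge0// => i _; exact: sqr_ge0.
have S0 : S 0 by rewrite /S /= vol0// lee_fin ltW.
have Sub : has_ubound S.
  exists (d.+1%:R * (v + 1) ^+ 2) => rho /= Srho; rewrite leNgt; apply/negP.
  by move/(vol_qball_large (ltW v0)); rewrite ltNge Srho.
have Ssup : has_sup S by split; [exists 0|].
have mono rho rho' : rho <= rho' -> (vol (qball rho) <= vol (qball rho'))%E.
  move=> rr'; apply: le_vol; try exact: vol_measurable_qball.
  by move=> x; rewrite /qball /= => /lt_le_trans; apply.
have E : vol (qball (sup S)) = v%:E.
  apply/eqP; rewrite eq_le; apply/andP; split.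
    apply: vol_qball_left => rho rhoS.
    have e0 : 0 < sup S - rho by rewrite subr_gt0.
    have [rho' Srho'] := sup_adherent e0 Ssup; rewrite subKr => rr'.
    by apply: le_trans Srho'; apply: mono; exact: ltW.
  apply: vol_qball_right => rho rhoS; rewrite leNgt; apply/negP => /ltW Srho.
  by move: rhoS; rewrite ltNge; move/negP; apply; exact: ub_le_sup.
exists (sup S) => //; rewrite ltNge; apply/negP => /vol0; rewrite E => -[v00].
by rewrite v00 ltxx in v0.
Qed.

Lemma eball0E r : 0 < r -> @eball R d.+1 0 r = qball (r ^+ 2).
Proof.
move=> r0; apply/seteqP; split => x; rewrite /eball /qball /=;
  have -> : \sum_i (x 0 i - (0 : 'rV[R]_d.+1) 0 i) ^+ 2 = \sum_i x 0 i ^+ 2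
    by apply: eq_bigr => i _; rewrite mxE subr0.
  move=> xr; have s0 : 0 <= \sum_i x 0 i ^+ 2 by apply: sumr_ge0 => i _; exact: sqr_ge0.
  by rewrite -(sqr_sqrtr s0) ltrXn2r ?nnegrE ?sqrtr_ge0// ltW.
by move=> xr; rewrite -[ltRHS](gtr0_norm r0) -sqrtr_sqr ltr_sqrt// exprn_gt0.
Qed.

(** A larger radius would make the ball contain the cube of half-side [v + 1], whose volume exceeds
    [v]. Linear growth of the bound in [v] is enough later. *)
Lemma vol_eball_surj (v : R) : 0 < v ->
  exists2 r, 0 < r <= d.+1%:R * (v + 1) & vol (@eball R d.+1 0 r) = v%:E.
Proof.
move=> v0; have [rho rho0 rhoE] := vol_qball_surj v0.
exists (Num.sqrt rho); last by rewrite eball0E ?sqrtr_gt0// sqr_sqrtr// ltW.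
rewrite sqrtr_gt0 rho0 /= -[leRHS]ger0_norm ?mulr_ge0//; last lra.
rewrite -sqrtr_sqr ler_sqrt; last exact: sqr_ge0.
rewrite leNgt; apply/negP => H.
suff /(vol_qball_large (ltW v0)) : d.+1%:R * (v + 1) ^+ 2 < rho.
  by rewrite rhoE ltxx.
apply: le_lt_trans H; rewrite exprMn ler_wpM2r ?sqr_ge0//.
by rewrite ler_eXnr// ler1n.
Qed.

End Balls.

(** * Lattice simplices of positive and bounded volume *)

Section Simplices.
Variables (R : realType) (d : nat).
Implicit Types (B : 'M[R]_d) (x y : 'rV[R]_d).

Lemma vol_measurable_simplex B : vol_measurable (simplex B).
Proof.
have mlin i : coord_measurable (fun x : 'rV[R]_d => (x *m invmx B) 0 i).
  rewrite /coord_measurable; under eq_fun do rewrite mxE.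
  apply: (@measurable_sum _ (d.-tuple (measurableTypeR R)) R setT _ _
    (fun j t => (\row_l tnth t l) 0 j * invmx B j i)) => j.
  apply: measurable_funM; first exact: coord_measurable_coord.
  exact: measurable_cst.
apply: vol_measurableI.
  apply: (vol_measurable_forall (F := fun i => [set x | 0 <= (x *m invmx B) 0 i])) => i.
  by apply: vol_measurable_le => //; exact: coord_measurable_cst.
apply: vol_measurable_le; last exact: coord_measurable_cst.
apply: (@measurable_sum _ (d.-tuple (measurableTypeR R)) R setT _ _
    (fun i t => ((\row_l tnth t l) *m invmx B) 0 i)) => i; exact: mlin.
Qed.

Lemma simplex_sub_box B : B \in unitmx ->
  exists x0 : 'rV[R]_d, exists2 e : R, 0 < e &
    forall x, (forall i, `|x 0 i - x0 0 i| <= e) -> simplex B x.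
Proof.
(* The center has all coordinates [c] in the basis [B]. By the choice of [M], a perturbation of size
   [c / M] keeps them in [0, 2c], and [d] such numbers sum to at most 1. *)
move=> uB; pose c : R := (2 * d.+1%:R)^-1; pose c0 : 'rV[R]_d := const_mx c.
have cpos : 0 < c by rewrite invr_gt0 mulr_gt0.
pose M := 1 + \sum_i \sum_j `|invmx B i j|.
have M0 : 0 < M by rewrite ltr_wpDr// sumr_ge0// => i _; rewrite sumr_ge0.
exists (c0 *m B), (c / M); first by rewrite divr_gt0.
move=> x xe.
have H i : `|(x *m invmx B) 0 i - c| <= c.
  have -> : (x *m invmx B) 0 i - c = ((x - c0 *m B) *m invmx B) 0 i.
    by rewrite mulmxBl mulmxK// !mxE.
  rewrite mxE; apply: (le_trans (ler_norm_sum _ _ _)).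
  apply: (@le_trans _ _ (\sum_j c / M * `|invmx B j i|)).
    apply: ler_sum => j _; rewrite normrM ler_wpM2r//.
    by have := xe j; rewrite !mxE.
  rewrite -mulr_sumr mulrAC ler_pdivrMr// ler_wpM2l ?(ltW cpos)//.
  apply: (@le_trans _ _ (\sum_i \sum_j `|invmx B i j|)); last by rewrite /M lerDr.
  by apply: ler_sum => j _; rewrite (bigD1 i)//= lerDl sumr_ge0.
have H' i : 0 <= (x *m invmx B) 0 i <= c *+ 2.
  by have := H i; rewrite ler_distl subrr mulr2n.
split=> [i|]; first by have /andP[] := H' i.
apply: (@le_trans _ _ (\sum_(i < d) c *+ 2)).
  by apply: ler_sum => i _; have /andP[] := H' i.
rewrite sumr_const card_ord -mulr_natr -[c *+ 2]mulr_natl mulrAC /c.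
by rewrite ler_pdivrMr ?mulr_gt0// mul1r ler_pM2l// ler_nat.
Qed.

Lemma simplex_lattice_polytope B : B \in unitmx -> B \is a mxOver Num.int ->
  lattice_polytopes (simplex B).
Proof.
move=> uB Bint; split.
- by eexists; exact: simplexE.
- have [x0 [e e0 He]] := simplex_sub_box uB.
  exists x0; apply/nbhs_ballP; exists e => //= y [_ Hy].
  by apply: He => i; rewrite distrC ltW//; exact: Hy.
- move=> v; rewrite simplexE// => /vertex_convex_hull /=.
  rewrite inE => /orP[/eqP ->|/mapP[i _ ->]]; rewrite /Zlat /=.
    by apply/mxOverP => i j; rewrite mxE rpred0.
  by apply/mxOverP => i' j; rewrite mxE; exact/mxOverP.
Qed.

Lemma vol_simplex_gt0 B : B \in unitmx -> (0 < vol (simplex B))%E.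
Proof.
move=> uB; have [x0 [e e0 He]] := simplex_sub_box uB.
apply: (@lt_le_trans _ _ (vol (box (x0 - const_mx e) (x0 + const_mx e)))).
  rewrite vol_box => [|i]; last by rewrite !mxE; lra.
  by rewrite lte_fin prodr_gt0// => i _; rewrite !mxE; lra.
apply: le_vol; [exact: vol_measurable_box|exact: vol_measurable_simplex|].
by move=> x xb; apply: He => i; have := xb i; rewrite !mxE ler_distl.
Qed.

(** Row [q] is e_q + a e_p and the other rows are unit vectors: a distant lattice vertex at bounded
    volume. *)
Definition shear (q p : 'I_d) (a : int) : 'M[R]_d := 1%:M + a%:~R *: delta_mx q p.

Lemma shear_mulN q p a : q != p -> shear q p a *m (1%:M - a%:~R *: delta_mx q p) = 1%:M.
Proof.
move=> qp; rewrite /shear mulmxDl mul1mx mulmxBr mulmx1 -scalemxAl -scalemxAr.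
by rewrite mul_delta_mx_0 1?eq_sym// !scaler0 subr0 subrK.
Qed.

Lemma shear_unit q p a : q != p -> shear q p a \in unitmx.
Proof. by move=> /(shear_mulN a)/mulmx1_unit[]. Qed.

Lemma invmx_shear q p a : q != p ->
  invmx (shear q p a) = 1%:M - a%:~R *: delta_mx q p.
Proof.
by move=> qp; rewrite -[RHS](mulKmx (shear_unit a qp)) shear_mulN// mulmx1.
Qed.

Lemma shear_int q p a : shear q p a \is a mxOver Num.int.
Proof.
apply/mxOverP => i j; rewrite !mxE rpredD// ?rpredM// ?intr_int//.
  by case: eqP => _; rewrite ?rpred0 ?rpred1.
by case: andP => _; rewrite ?rpred0 ?rpred1.
Qed.

Lemma simplex_shear q p a x : q != p -> simplex (shear q p a) x ->
  (forall i, i != p -> 0 <= x 0 i <= 1) /\ 0 <= x 0 p - a%:~R * x 0 q <= 1.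
Proof.
move=> qp; rewrite /simplex /= invmx_shear// => -[H0 H1].
have E i : (x *m (1%:M - a%:~R *: delta_mx q p)) 0 i =
    x 0 i - a%:~R * x 0 q * (i == p)%:R.
  rewrite mulmxBr mulmx1 -scalemxAr !mxE (bigD1 q)//= big1 => [|j jq].
    by rewrite addr0 !mxE eqxx /= mulrA.
  by rewrite !mxE (negbTE jq) mulr0.
have H i : 0 <= x 0 i - a%:~R * x 0 q * (i == p)%:R <= 1.
  rewrite -E H0 /=; apply: le_trans H1.
  by rewrite (bigD1 i)//= lerDl sumr_ge0.
split=> [i ip|]; first by have := H i; rewrite (negbTE ip) mulr0 subr0.
by have := H p; rewrite eqxx mulr1.
Qed.

(* The sheared simplex lies above the unit segment of the coordinate [q]; it is
   cut along this segment into pieces over which [a * x_q] varies by at most 1. *)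
Lemma vol_simplex_shear q p a : q != p -> (vol (simplex (shear q p a)) <= 6%:E)%E.
Proof.
move=> qp; pose n : nat := (`|a|).+1.
pose lo (j : nat) : 'rV[R]_d := \row_i (if i == q then j%:R / n%:R else
  if i == p then a%:~R * j%:R / n%:R - 1 else 0).
pose hi (j : nat) : 'rV[R]_d := \row_i (if i == q then j.+1%:R / n%:R else
  if i == p then a%:~R * j%:R / n%:R + 2 else 1).
have n0 : 0 < n%:R :> R by rewrite ltr0n.
have volj j : vol (box (lo j) (hi j)) = (3 / n%:R)%:E.
  have jj : j%:R / n%:R <= j.+1%:R / n%:R :> R.
    by rewrite ler_pM2r ?invr_gt0// ler_nat.
  rewrite vol_box => [|i]; last first.
    by rewrite !mxE; case: ifP => // _; case: ifP => // _; lra.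
  rewrite (bigD1 q)//= (bigD1 p) 1?eq_sym//= big1 => [|i /andP[iq ip]].
    rewrite !mxE eqxx [p == q]eq_sym (negbTE qp) eqxx mulr1 opprD addrACA.
    by rewrite subrr add0r opprK -mulrBl -natrB// subSnn mul1r mulrC natr1.
  by rewrite !mxE (negbTE iq) (negbTE ip) subr0.
(* Slices of width 1 / n are numbered from 0 to [n] included, since x_q = 1 falls into the last
   one. *)
apply: (@le_trans _ _ (vol [set x | exists2 j, (j < n.+1)%N & box (lo j) (hi j) x])).
  apply: le_vol; first exact: vol_measurable_simplex.
    have -> : [set x | exists2 j, (j < n.+1)%N & box (lo j) (hi j) x] =
       \bigcup_(j in `I_n.+1) box (lo j) (hi j) by [].
    apply: (@fin_bigcup_measurable _ _ _ `I_n.+1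
      (fun j => [set t : d.-tuple (measurableTypeR R) | box (lo j) (hi j) (\row_i tnth t i)])).
      exact: finite_II.
    by move=> j _; exact: vol_measurable_box.
  move=> x /(simplex_shear qp)[xi xp].
  have /andP[xq0 xq1] := xi _ qp.
  have nx0 : 0 <= n%:R * x 0 q by rewrite mulr_ge0.
  have /andP[j1 j2] := truncn_itv nx0; set j := Num.truncn _ in j1 j2.
  exists j => /=.
    rewrite ltnS -(ler_nat R) (le_trans j1)// ler_piMr//.
  have q1 : j%:R / n%:R <= x 0 q by rewrite ler_pdivrMr// mulrC.
  have q2 : x 0 q <= j.+1%:R / n%:R by rewrite ler_pdivlMr// mulrC ltW.
  move=> i; rewrite !mxE; case: ifP => [/eqP ->|iq]; first by rewrite q1 q2.
  case: ifP => [/eqP ->|/negbT ip]; last exact: xi.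
  have : `|a%:~R * (x 0 q - j%:R / n%:R)| <= 1.
    rewrite normrM (ger0_norm (_ : 0 <= x 0 q - _)) ?subr_ge0//.
    apply: (@le_trans _ _ (n%:R * (n%:R)^-1)); last by rewrite divff// gt_eqF.
    apply: ler_pM => //; first by rewrite subr_ge0.
      by rewrite -intr_norm [n%:R]pmulrn ler_int /n; lia.
    by rewrite lerBlDr (le_trans q2)// -natr1 mulrDl mul1r addrC.
  rewrite mulrBr ler_norml mulrA; lra.
apply: le_trans (vol_bigsetU_le n.+1 (fun j => vol_measurable_box (lo j) (hi j))) _.
(* The n + 1 boxes of volume 3 / n add up to at most 6, as n >= 1. *)
rewrite (eq_bigr (fun=> (3 / n%:R)%:E)) => [|j _]; last exact: volj.
rewrite sumEFin lee_fin sumr_const card_ord -[leLHS]mulr_natr mulrAC ler_pdivrMr//.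
by rewrite -!natrM ler_nat; lia.
Qed.

End Simplices.

Lemma simplex_scalar1 (R : realType) (N : nat) (x : 'rV[R]_1) : (0 < N)%N ->
  simplex (N%:R%:M : 'M[R]_1) x <-> 0 <= x 0 0 <= N%:R.
Proof.
move=> N0; have N0' : 0 < N%:R :> R by rewrite ltr0n.
rewrite /simplex /= big_ord1 invmx_scalar mul_mx_scalar !mxE.
rewrite mulrC ler_pdivrMr// mul1r; split.
  by move=> [/(_ 0) + ->]; rewrite mxE pmulr_rge0 ?invr_gt0// => ->.
move=> /andP[x0 ->]; split=> // i; rewrite (ord1 i) mxE mulr_ge0// invr_ge0 ltW//.
Qed.

(** * The star map and patches *)

Section Coordinates.
Variables (R : realType) (k d : nat).
Hypothesis dk : (d <= k)%N.
Local Notation V := 'rV[R]_k.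
Implicit Types (u v : V) (x : 'rV[R]_d).

Definition vhead v : 'rV[R]_d := \row_i v 0 (widen_ord dk i).

Lemma embed_widen x i : embed k x 0 (widen_ord dk i) = x 0 i.
Proof. by rewrite mxE insubT//= => lt_id; congr (x 0 _); exact: val_inj. Qed.

Lemma embed_ge x (i : 'I_k) : (d <= i)%N -> embed k x 0 i = 0.
Proof. by rewrite mxE leqNgt => di; rewrite insubF//; exact/negbTE. Qed.

Lemma ord_ltnP (i : 'I_k) :
  (exists j, i = widen_ord dk j) \/ (d <= i)%N.
Proof.
have [di|id] := leqP d i; first by right.
by left; exists (Ordinal id); exact: val_inj.
Qed.

Lemma vhead_embed x : vhead (embed k x) = x.
Proof. by apply/rowP => i; rewrite mxE embed_widen. Qed.

Lemma embed_int x : Zlat x -> Zlat (embed k x).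
Proof.
move=> /mxOverP xZ; apply/mxOverP => i j; rewrite (ord1 i).
have [[l ->]|/embed_ge ->] := ord_ltnP j; last exact: rpred0.
by rewrite embed_widen.
Qed.

Lemma memv_Frho v : (v \in Frho R k d) <-> forall i, v 0 (widen_ord dk i) = 0.
Proof.
split=> [vF i|v0].
  rewrite (@coord_span _ _ _ (in_tuple [seq _ | i <- _ & _]) v vF) summxE.
  apply: big1 => l _; rewrite mxE; set X := in_tuple _ in l *.
  have /mapP[j] : X`_l \in (X : seq V) by apply: mem_nth; exact: ltn_ord.
  rewrite mem_filter => /andP[dj _] ->; rewrite mxE eqxx /=.
  by case: eqP => [ij|_]; [move: dj; rewrite -ij /= leqNgt ltn_ord|rewrite mulr0].
rewrite (row_sum_delta v); apply: memv_suml => i _.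
have [[j ->]|di] := ord_ltnP i; first by rewrite v0 scale0r mem0v.
apply: memvZ; apply: memv_span; apply/mapP; exists i => //.
by rewrite mem_filter di mem_enum.
Qed.

End Coordinates.

Section CutAndProject.
Variables (R : realType) (k d : nat).
Hypothesis dk : (d <= k)%N.
Variable c : cp_data R k d.
Local Notation V := 'rV[R]_k.
Local Notation s := (cp_shift c).
Local Notation rho := (cp_rho c).
Local Notation pi := (cp_pi c).
Local Notation vhead := (@vhead R k d dk).
Implicit Types (u v z : V) (x : 'rV[R]_d) (i j : 'I_k).

(** The component along [Frho]: its coordinates of index at least [d] locate [v] relative to the
    window, and the others vanish. *)
Definition star v i : R := (v - rho v) 0 i.

Lemma starD u v i : star (u + v) i = star u i + star v i.
Proof. by rewrite /star /cp_rho linearD opprD addrACA mxE. Qed.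

Lemma starZ (a : R) v i : star (a *: v) i = a * star v i.
Proof. by rewrite /star /cp_rho linearZ -scalerBr mxE. Qed.

Lemma starN v i : star (- v) i = - star v i.
Proof. by rewrite -scaleN1r starZ mulN1r. Qed.

Lemma starB u v i : star (u - v) i = star u i - star v i.
Proof. by rewrite starD starN. Qed.

Lemma star_sum (I : finType) (F : I -> V) i :
  star (\sum_j F j) i = \sum_j star (F j) i.
Proof.
apply: (big_morph (star^~ i)) => [u v|]; first exact: starD.
by rewrite -(scale0r (0 : V)) starZ mul0r.
Qed.

Lemma rho_E u : u \in cp_E c -> rho u = u.
Proof. by move=> uE; apply: daddv_pi_id => //; case: (cp_compl_rho c). Qed.

Lemma sub_rho_Frho v : v - rho v \in Frho R k d.
Proof.
have [EF E0] := cp_compl_rho c.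
rewrite -{1}(@daddv_pi_add _ _ _ _ v E0) ?EF ?memvf// addrC addKr.
exact: memv_pi.
Qed.

Lemma rho_Frho u : u \in Frho R k d -> rho u = 0.
Proof.
move=> uF; have [EF E0] := cp_compl_rho c.
have : rho u + daddv_pi (Frho R k d) (cp_E c) u = u.
  by apply: daddv_pi_add => //; rewrite EF memvf.
rewrite daddv_pi_id ?[(Frho _ _ _ :&: _)%VS]capvC//.
by move=> /(canRL (addrK _)) ->; rewrite subrr.
Qed.

Lemma star_E u i : u \in cp_E c -> star u i = 0.
Proof. by move=> uE; rewrite /star rho_E// subrr mxE. Qed.

Lemma star_Frho u i : u \in Frho R k d -> star u i = u 0 i.
Proof. by move=> uF; rewrite /star rho_Frho// subr0. Qed.

Lemma star_widen v (i : 'I_d) : star v (widen_ord dk i) = 0.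
Proof. exact: ((memv_Frho dk _).1 (sub_rho_Frho v)). Qed.

Lemma vhead_rho v : vhead (rho v) = vhead v.
Proof.
apply/rowP => i; rewrite !mxE; have := star_widen v i.
by rewrite /star !mxE => /eqP; rewrite subr_eq0 => /eqP.
Qed.

Lemma sub_embed_head v : v - embed k (vhead v) \in Frho R k d.
Proof. by apply/(memv_Frho dk) => i; rewrite mxE [X in _ + X]mxE embed_widen mxE subrr. Qed.

(** Removing the head leaves a vector of [Frho], on which [star] reads coordinates. Hence the head
    of a lattice point determines its star coordinates modulo integers. *)
Lemma star_head v i : (d <= i)%N -> star v i = star (embed k (vhead v)) i + v 0 i.
Proof.
move=> di; rewrite -[in LHS](subrKC (embed k (vhead v)) v) starD; congr (_ + _).
by rewrite star_Frho ?sub_embed_head// mxE [X in _ + X]mxE embed_ge// oppr0 addr0.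
Qed.

Lemma star_delta i j : (d <= i)%N -> (d <= j)%N ->
  star (delta_mx 0 j) i = (i == j)%:R.
Proof.
move=> di dj; rewrite star_Frho ?mxE ?eqxx//.
apply/(memv_Frho dk) => l; rewrite mxE eqxx /=; case: eqP => // lj.
by move: dj; rewrite -lj /= leqNgt ltn_ord.
Qed.

Lemma rho_eq_head u v : vhead u = vhead v -> rho u = rho v.
Proof.
have rhoE w : rho w = rho (embed k (vhead w)).
  have := rho_Frho (sub_embed_head w); rewrite /cp_rho linearB => /eqP.
  by rewrite subr_eq0 => /eqP.
by move=> uv; rewrite rhoE uv -rhoE.
Qed.

(** [rho] kills [Frho], so [rho v] is determined by the head of [v]. *)
Lemma in_E_rho (O : set 'rV[R]_d) v : in_E c O (rho v) <-> O (vhead v).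
Proof.
split=> [[_ [x Ox <-]]|Ov].
  by move=> /(congr1 vhead); rewrite !vhead_rho vhead_embed => <-.
by exists (embed k (vhead v)); [exists (vhead v)|apply: rho_eq_head; rewrite vhead_embed].
Qed.

Hypothesis cubical : cubical_window c.

Lemma windowP v : v \in Frho R k d ->
  strip c v <-> forall i, (d <= i)%N -> 0 <= v 0 i < 1.
Proof.
move=> vF; have vsum : \sum_(i < k | (d <= i)%N) v 0 i *: delta_mx 0 i = v.
  rewrite [RHS]row_sum_delta [RHS](bigID (fun i : 'I_k => (d <= i)%N)) /=.
  rewrite [X in _ + X]big1 ?addr0// => i di.
  have [[j ->]|id] := ord_ltnP dk i; last by rewrite id in di.
  by rewrite ((memv_Frho dk _).1 vF) scale0r.
split=> [vS|v01].
  have : (strip c `&` [set u | u \in Frho R k d]) v by [].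
  rewrite cubical => -[t t01 <-] i di; rewrite summxE (bigD1 i)//= big1.
    by rewrite !mxE !eqxx mulr1 addr0; exact: t01.
  by move=> j /andP[_ ji]; rewrite !mxE [i == j]eq_sym (negbTE ji) andbF mulr0.
suff [] : (strip c `&` [set u | u \in Frho R k d]) v by [].
rewrite cubical; exists (fun i => if (d <= i)%N then v 0 i else 0).
  by move=> i /=; case: ifP => [/v01//|_]; rewrite lexx ltr01.
by rewrite -[RHS]vsum; apply: eq_bigr => i ->.
Qed.

Lemma strip_addE v u : u \in cp_E c -> strip c v -> strip c (v + u).
Proof.
by move=> uE [w Ww [e eE <-]]; exists w => //; exists (e + u); rewrite ?addrA//; exact: rpredD.
Qed.

(** The strip is invariant under [E], so [v] may be replaced by [v - rho v] in [Frho], where the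
    strip is the unit cube. *)
Lemma stripP v : strip c v <-> forall i, (d <= i)%N -> 0 <= star v i < 1.
Proof.
rewrite -(windowP (sub_rho_Frho v)); split=> vS.
  by apply: strip_addE => //; rewrite rpredN; exact: memv_pi.
by rewrite -(subrK (rho v) v); apply: strip_addE => //; exact: memv_pi.
Qed.

(** The lattice points that label the cut and project set through [pi (z + s)]; injectivity of [pi]
    on the lattice makes labels unique. *)
Definition cp_index z := Zlat z /\ strip c (z + s).

Lemma cp_setP y : cp_set c y <-> exists2 z, cp_index z & y = pi (z + s).
Proof.
split=> [[v [Sv [z zZ zv]] <-]|[z [zZ Sz] ->]].
  by exists z; rewrite /cp_index zv.
by exists (z + s) => //; split=> //; exists z.
Qed.

Lemma cp_liftK z : Zlat z -> cp_lift c (pi (z + s)) = z.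
Proof.
move=> zZ; apply: xget_unique => // z' [z'Z]; rewrite /cp_pi !linearD => /addIr zz'.
by apply: (cp_inj _ _ zz'); rewrite inE.
Qed.

Lemma patchP z (O : set 'rV[R]_d) y : Zlat z ->
  Defs.patch c (pi (z + s)) O y <->
  exists2 z', cp_index z' & y = pi (z' + s) /\ O (vhead (z' - z)).
Proof.
move=> zZ; rewrite /Defs.patch /= (cp_liftK zZ); split.
  move=> [/cp_setP[z' z'I ->]]; rewrite cp_liftK; last by case: z'I.
  by move/in_E_rho => ?; exists z'.
move=> [z' z'I [-> Oz]]; split; first by apply/cp_setP; exists z'.
by rewrite cp_liftK; [exact/in_E_rho|case: z'I].
Qed.

Lemma ZlatD u v : Zlat u -> Zlat v -> Zlat (u + v).
Proof.
move=> /mxOverP uZ /mxOverP vZ; apply/mxOverP => i j.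
by rewrite !mxE rpredD.
Qed.

Lemma ZlatB u v : Zlat u -> Zlat v -> Zlat (u - v).
Proof.
move=> /mxOverP uZ /mxOverP vZ; apply/mxOverP => i j.
by rewrite !mxE rpredB.
Qed.

(** The translation between the two patches sends the point labelled [z2 + D] to [pi (z1 + D + s)],
    and uniqueness of labels identifies the label of the image. *)
Lemma patch_equiv_shift (O : set 'rV[R]_d) z1 z2 D :
  cp_index z1 -> cp_index z2 ->
  patch_equiv c O (pi (z1 + s)) (pi (z2 + s)) ->
  cp_index (z2 + D) -> O (vhead D) -> cp_index (z1 + D).
Proof.
move=> [z1Z _] [z2Z _] eq12 z2D OD.
have : Defs.patch c (pi (z1 + s)) O (pi (z2 + D + s) + pi (z1 + s) - pi (z2 + s)).
  rewrite eq12; exists (pi (z2 + D + s)) => //.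
  by apply/patchP => //; exists (z2 + D) => //; split=> //; rewrite [z2 + D]addrC addrK.
move=> /(patchP _ _ z1Z)[z' [z'Z z'S] [piz' _]].
suff -> : z1 + D = z' by split.
have Dz : Zlat (z1 + D).
  by apply: ZlatD => //; rewrite -(addrK z2 D) [D + _]addrC; apply: ZlatB => //; case: z2D.
suff zz' : pi (z1 + D) = pi z' by apply: (cp_inj _ _ zz'); rewrite inE.
have piD u : pi (u + s) = pi u + pi s by rewrite /cp_pi linearD.
apply: (addIr (pi s)); rewrite -!piD -piz' /cp_pi -linearD -linearB.
by congr (daddv_pi _ _ _); apply/rowP => j; rewrite !mxE; ring.
Qed.

(** Subtracting the integer parts of the star coordinates along [Frho] moves the point into the
    strip and keeps its head. *)
Lemma cp_index_shift z : Zlat z -> exists2 z', cp_index z' & vhead z' = vhead z.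
Proof.
move=> zZ; pose f : V := \row_i if (d <= i)%N then (Num.floor (star (z + s) i))%:~R else 0.
have fF : f \in Frho R k d.
  by apply/(memv_Frho dk) => i; rewrite mxE /= leqNgt ltn_ord.
exists (z - f).
  split; first apply: ZlatB => //.
    by apply/mxOverP => i j; rewrite mxE; case: ifP; rewrite ?rpred0 ?intr_int.
  apply/stripP => i di; rewrite addrAC starB (star_Frho _ fF) mxE di.
  by have /andP[] := floor_itv (star (z + s) i); rewrite intrD; lra.
by apply/rowP => i; rewrite !mxE /= leqNgt ltn_ord /= subr0.
Qed.

Lemma int_lt1 (a : R) : a \is a Num.int -> 0 < a -> 1 <= a.
Proof. by move=> /intrP[n ->]; rewrite ltr0z ler1z. Qed.

(* Both patches contain the point at [m], so that [star (z1 + s) i] and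
   [star (z2 + s) i] are moved into the unit interval by the same integer
   shift of [star m i]. *)
Lemma patch_equiv_cell (O : set 'rV[R]_d) z1 z2 (m : 'rV[R]_d) i (t : R) :
  cp_index z1 -> cp_index z2 ->
  patch_equiv c O (pi (z1 + s)) (pi (z2 + s)) ->
  Zlat m -> O m -> (d <= i)%N -> t + star (embed k m) i \is a Num.int ->
  (star (z1 + s) i < t) = (star (z2 + s) i < t).
Proof.
move=> I1 I2 eq12 mZ Om di tint.
have [z [zZ zS] hz] := cp_index_shift (ZlatD I2.1 (embed_int dk mZ)).
pose D := z - z2; have DZ : Zlat D by apply: ZlatB => //; case: I2.
have hD : vhead D = m.
  apply/rowP => j; move/rowP/(_ j): hz; rewrite /D !mxE => ->.
  by have := embed_widen dk m j; rewrite mxE => ->; rewrite addrC addKr.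
have I2D : cp_index (z2 + D) by rewrite /D subrKC.
have I1D : cp_index (z1 + D) by apply: (patch_equiv_shift I1 I2 eq12); rewrite ?hD.
have nint : t + star D i \is a Num.int.
  rewrite (star_head _ di) hD addrA rpredD//; exact: (mxOverP DZ).
have := (stripP _).1 I1D.2 i di; have := (stripP _).1 I2D.2 i di.
rewrite ![z1 + D + s]addrAC ![z2 + D + s]addrAC !(starD _ D).
(* Adding [star D i] to both sides turns each inequality into a comparison of a number of [0, 1)
   with the integer [t + star D i]: it always holds if this integer is at least 1, and never
   otherwise. *)
have [t1|t0] := leP 1 (t + star D i).
  by move=> /andP[? ?] /andP[? ?]; apply/idP/idP => _; lra.
have {}t0 : t + star D i <= 0.
  by rewrite leNgt; apply/negP => /(int_lt1 nint); rewrite leNgt t0.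
by move=> /andP[? ?] /andP[? ?]; apply/idP/idP => ?; lra.
Qed.

End CutAndProject.

(** * Approximation *)

Section Approximation.
Variable R : realType.

Lemma exists_pos_lower_bound (I : finType) (f : I -> R) :
  (forall i, 0 < f i) -> exists2 e, 0 < e & forall i, e <= f i.
Proof.
move=> f0; exists (\big[Num.min/1]_i f i); first exact: lt_bigmin.
by move=> i; exact: bigmin_le_cond.
Qed.

Definition irrational_coef (a : R) := forall Q : nat, (0 < Q)%N -> Q%:R * a \isn't a Num.int.

Lemma int_sign_nat (M : int) : (M != 0) ->
  exists2 Q : nat, (0 < Q)%N & exists e : int, Q%:R = e%:~R * M%:~R :> R.
Proof.
move=> M0; exists `|M|%N; first by rewrite absz_gt0.
by exists (sgz M); rewrite -intrM -abszEsg -pmulrn.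
Qed.

(* A positive element of Z + a Z leaves a nonzero remainder in [1] or in [a], as
   otherwise [a] would be rational. *)
Lemma irrational_small (a : R) : irrational_coef a ->
  forall e : R, 0 < e -> exists n m : int, 0 < n%:~R + m%:~R * a < e.
Proof.
move=> irr.
(* A remainder r strictly between 0 and g gives an element at most g / 2, namely r or g - r;
   iterated halving goes below [e]. *)
have half (n m : int) (g := n%:~R + m%:~R * a) : 0 < g ->
    exists n' m' : int, 0 < n'%:~R + m'%:~R * a <= g / 2.
  move=> g0.
  pose rem (x : R) := x - (Num.floor (x / g))%:~R * g.
  have remP x : 0 <= rem x < g.
    have /andP[] := floor_itv (x / g); rewrite /rem intrD.
    by rewrite ler_pdivlMr// ltr_pdivrMr// mulrDl mul1r subr_ge0 ltrBlDl => -> ->.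
  have [n1 [m1 E1]] : exists n1 m1 : int, rem 1 = n1%:~R + m1%:~R * a.
    exists (1 - Num.floor (1 / g) * n), (- Num.floor (1 / g) * m).
    by rewrite /rem /g !(intrD, intrM, mulrNz); ring.
  have [n2 [m2 E2]] : exists n1 m1 : int, rem a = n1%:~R + m1%:~R * a.
    exists (- Num.floor (a / g) * n), (1 - Num.floor (a / g) * m).
    by rewrite /rem /g !(intrD, intrM, mulrNz); ring.
  have split_rem (r : R) (p q : int) : r = p%:~R + q%:~R * a -> 0 < r < g ->
      exists n' m' : int, 0 < n'%:~R + m'%:~R * a <= g / 2.
    move=> rE /andP[r0 rg]; have [rg2|rg2] := leP r (g / 2).
      by exists p, q; rewrite -rE r0.
    exists (n - p), (m - q); rewrite !intrD !mulrNz.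
    have -> : n%:~R - p%:~R + (m%:~R - q%:~R) * a = g - r by rewrite rE /g; ring.
    by lra.
  have [r1|r1] := eqVneq (rem 1) 0; last first.
    have /andP[r0 rg] := remP 1.
    by apply: (split_rem _ _ _ E1); rewrite lt_neqAle eq_sym r1 r0.
  have [r2|r2] := eqVneq (rem a) 0; last first.
    have /andP[r0 rg] := remP a.
    by apply: (split_rem _ _ _ E2); rewrite lt_neqAle eq_sym r2 r0.
  (* Here 1 = M g and a = M' g, so M a = M' is an integer. *)
  move: r1 r2; rewrite /rem; set M := Num.floor _; set M' := Num.floor _ => r1 r2.
  have M0 : M != 0.
    by apply/eqP => M0; move: r1; rewrite M0 mul0r subr0 => /eqP; rewrite oner_eq0.
  have [Q Q0 [e QE]] := int_sign_nat M0.
  have /negP[] := irr Q Q0.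
  have -> : Q%:R * a = (e * M')%:~R.
    have aE : a = M'%:~R * g by apply/eqP; rewrite -subr_eq0 r2.
    have gE : M%:~R * g = 1 by apply/esym/eqP; rewrite -subr_eq0 r1.
    by rewrite QE aE intrM mulrCA -mulrA gE mulr1 mulrC.
  exact: intr_int.
have iterate (j : nat) : exists n m : int, 0 < n%:~R + m%:~R * a <= (2 ^+ j)^-1.
  elim: j => [|j [n [m /andP[g0 gj]]]].
    by exists 1, 0; rewrite mul0r addr0 expr0 invr1 ltr01 lexx.
  have [n' [m' /andP[g'0 g'g]]] := half n m g0; exists n', m'; rewrite g'0 /=.
  by apply: le_trans g'g _; rewrite exprSr invfM ler_pM2r// invr_gt0.
move=> e e0.
have [n [m /andP[g0 ge]]] := iterate (Num.truncn e^-1).+1.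
exists n, m; rewrite g0 /=; apply: le_lt_trans ge _.
rewrite invf_plt ?posrE ?exprn_gt0//.
have ei0 : 0 <= e^-1 by rewrite invr_ge0 ltW.
have /andP[_ e1] := truncn_itv ei0; apply: (lt_trans e1).
by rewrite -natrX ltr_nat ltn_expl.
Qed.

(** Multiples of a small positive step [g] bring [b] into the interval from 0 (excluded) to [g]; [K]
    is the multiplier that does so. *)
Lemma irrational_dense (a b : R) : irrational_coef a ->
  forall e : R, 0 < e -> exists n m : int, 0 < n%:~R + m%:~R * a + b < e.
Proof.
move=> irr e e0; have [n [m]] := irrational_small irr e0.
set g := _ + _ => /andP[g0 ge].
pose K := 1 - Num.ceil (b / g).
exists (K * n), (K * m).
have -> : (K * n)%:~R + (K * m)%:~R * a + b = b + K%:~R * g.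
  by rewrite !intrM /g; ring.
have /andP[] := ceil_itv (b / g); rewrite /K intrD mulrNz intrB.
rewrite ltr_pdivlMr// ler_pdivrMr// => b1 b2.
by rewrite mulrDl mulNr; move: b1 b2; rewrite mulrBl; lra.
Qed.

End Approximation.

(** * Density of star coordinates and its consequences *)

Section Density.
Variables (R : realType) (k d : nat).
Hypothesis dk : (d <= k)%N.
Variable c : cp_data R k d.
Hypotheses (cubical : cubical_window c) (dense_E : totally_irrational c).
Local Notation V := 'rV[R]_k.
Local Notation s := (cp_shift c).
Local Notation star := (star c).
Implicit Types (u v z : V) (i j : 'I_k).

Lemma star_coords v i : star v i = \sum_j v 0 j * star (delta_mx 0 j) i.
Proof.
rewrite {1}(row_sum_delta v) star_sum; apply: eq_bigr => j _.
by rewrite starZ.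
Qed.

(** The lattice translates of a cube around [v] form an open set that is invariant under the
    lattice, hence the preimage of an open set of the torus, which meets the dense image of [E]. *)
Lemma totally_irrational_approx v (e : R) : 0 < e ->
  exists2 u, u \in cp_E c & exists2 z, Zlat z & forall i, `|u 0 i - z 0 i - v 0 i| < e.
Proof.
move=> e0.
pose U := [set x : V | exists2 z, Zlat z & forall i, `|x 0 i - z 0 i - v 0 i| < e].
pose O : set (torus R k) := [set q | U (repr q)].
have UZ x y : torus_rel x y -> U x -> U y.
  move=> xy [z zZ zx]; exists (z - (x - y)); first exact: ZlatB.
  by move=> i; have := zx i; rewrite !mxE; congr (`|_| < _); ring.
have OE : @to_torus R k @^-1` O = U.
  have E (x : V) : torus_rel (repr (to_torus x)) x.
    by apply/(eqmodP (torus_equiv R k)); exact: reprK.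
  apply/seteqP; split => x /=; apply: UZ; first exact: E.
  have /mxOverP xx := E x; apply/mxOverP => i j.
  by rewrite mxE [X in _ + X]mxE -opprB rpredN; have := xx i j; rewrite mxE [X in _ + X]mxE.
have openO : open O.
  rewrite /open /= /quotient_open -/(to_torus _) [X in open X]OE openE => x [z zZ zx] /=.
  have gap i : 0 < e - `|x 0 i - z 0 i - v 0 i| by rewrite subr_gt0.
  have [r r0 rP] := exists_pos_lower_bound gap.
  apply/nbhs_ballP; exists r => //= y [_ xy]; exists z => // i.
  have := rP i; have := xy 0 i; rewrite /ball /= => xyi ri.
  have -> : y 0 i - z 0 i - v 0 i = (x 0 i - z 0 i - v 0 i) - (x 0 i - y 0 i) by ring.
  apply: le_lt_trans (ler_normB _ _) _; move: xyi ri; lra.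
have O0 : O !=set0.
  exists (to_torus v); change ((@to_torus R k @^-1` O) v); rewrite OE; exists 0.
    by apply/mxOverP => i j; rewrite mxE rpred0.
  by move=> i; rewrite !mxE subr0 subrr normr0.
have [q [Oq [u uE uq]]] := dense_E O0 openO.
have : U u by rewrite -OE /= uq.
by move=> [z zZ zu]; exists u => //; exists z.
Qed.

(** The point [p] of [Frho] with star coordinates [- t] is approximated by [u - z] with [u] in [E];
    since [star] vanishes on [E], [star z] is close to [t]. The constant [M] bounds the linear map
    [star]. *)
Lemma star_dense (t : 'I_k -> R) (e : R) : 0 < e ->
  exists2 z, Zlat z & forall i, (d <= i)%N -> `|star z i - t i| < e.
Proof.
move=> e0.
pose p : V := \row_i (if (d <= i)%N then - t i else 0).
have pF : p \in Frho R k d.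
  by apply/(memv_Frho dk) => i; rewrite mxE /= leqNgt ltn_ord.
pose M := 1 + \sum_i \sum_j `|star (delta_mx 0 j) i|.
have M0 : 0 < M by rewrite ltr_wpDr// sumr_ge0// => i _; rewrite sumr_ge0.
have [u uE [z zZ zu]] := totally_irrational_approx p (divr_gt0 e0 M0).
exists z => // i di.
have -> : star z i - t i = - star (u - z - p) i.
  by rewrite !starB (star_E _ uE) (star_Frho c i pF) mxE di; ring.
rewrite normrN star_coords; apply: le_lt_trans (ler_norm_sum _ _ _) _.
apply: (@le_lt_trans _ _ (\sum_j e / M * `|star (delta_mx 0 j) i|)).
  apply: ler_sum => j _; rewrite normrM ler_wpM2r//.
  by have := zu j; rewrite !mxE => /ltW.
rewrite -mulr_sumr mulrAC ltr_pdivrMr// ltr_pM2l//.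
apply: (@le_lt_trans _ _ (\sum_i \sum_j `|star (delta_mx 0 j) i|)); last first.
  by rewrite /M ltrDr.
by rewrite [leRHS](bigD1 i)//= lerDl sumr_ge0// => l _; rewrite sumr_ge0.
Qed.

Lemma cp_index_dense (a b : 'I_k -> R) :
  (forall i, 0 <= a i) -> (forall i, b i <= 1) -> (forall i, a i < b i) ->
  exists2 z, cp_index c z & forall i, (d <= i)%N -> a i < star (z + s) i < b i.
Proof.
move=> a0 b1 ab.
have gap i : 0 < b i - a i by rewrite subr_gt0.
have [e e0 eP] := exists_pos_lower_bound gap.
have e2 : 0 < e / 2 by rewrite divr_gt0.
(* The targets are the midpoints of the intervals, corrected by the shift; the tolerance is half of
   a lower bound for the widths. *)
have [z zZ zP] := star_dense (fun i => (a i + b i) / 2 - star s i) e2.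
have H i : (d <= i)%N -> a i < star (z + s) i < b i.
  move=> di; have := zP i di; have := eP i; rewrite starD ltr_norml.
  by move=> ? /andP[? ?]; apply/andP; split; lra.
exists z => //; split => //; apply/(stripP dk) => // i di.
by have /andP[? ?] := H i di; have := a0 i; have := b1 i; lra.
Qed.

(** Otherwise a common denominator [N] would confine the star coordinate of the lattice to multiples
    of 1 / N, which stay away from 1 / (2 N) and contradict density. *)
Lemma exists_irrational_coef i : (d <= i)%N ->
  exists p : 'I_d, irrational_coef (star (delta_mx 0 (widen_ord dk p)) i).
Proof.
move=> di; apply: contrapT => nex.
have /choice[Q QP] (p : 'I_d) : exists Q : nat, (0 < Q)%N /\
    Q%:R * star (delta_mx 0 (widen_ord dk p)) i \is a Num.int.
  apply: contrapT => nQ; apply: nex; exists p => Q Q0; apply/negP => QZ.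
  by apply: nQ; exists Q.
pose N := (\prod_p Q p)%N.
have N0 : (0 < N)%N by rewrite prodn_gt0// => p; case: (QP p).
have N0' : 0 < N%:R :> R by rewrite ltr0n.
have NZ z : Zlat z -> N%:R * star z i \is a Num.int.
  move=> /mxOverP zZ; rewrite star_coords mulr_sumr rpred_sum// => j _.
  rewrite mulrCA rpredM//.
  have [[p ->]|dj] := ord_ltnP dk j; last first.
    by rewrite (star_delta dk)// rpredM// ?natr_int// rpred_nat.
  by rewrite /N (bigD1 p)//= natrM mulrAC rpredM// ?natr_int//; case: (QP p).
have e0 : 0 < (4 * N%:R)^-1 :> R by rewrite invr_gt0 mulr_gt0.
have [z zZ /(_ i di)] := star_dense (fun=> (2 * N%:R)^-1) e0.
rewrite -(ltr_pM2l N0') -{1}(gtr0_norm N0') -normrM mulrBr !invfM.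
rewrite ![N%:R * (_^-1 * _)]mulrCA divff ?gt_eqF// !mulr1 ltr_norml.
have /intrP[n ->] := NZ z zZ; move=> /andP[n1 n2].
have : 0 < n%:~R :> R by lra.
have : n%:~R < 1 :> R by lra.
by rewrite ltr0z ltrz1; lia.
Qed.

(** The head fixes the star coordinate modulo integers, and the window selects the representative in
    [0, 1). *)
Lemma star_frac z i (a := star (embed k (vhead dk z) + s) i) :
  (d <= i)%N -> cp_index c z -> star (z + s) i = a - (Num.floor a)%:~R.
Proof.
move=> di [/mxOverP zZ zS].
have /intrP[n nE] := zZ 0 i.
have aE : star (z + s) i = a + n%:~R.
  by rewrite /a !starD (star_head dk c z di) nE addrAC.
have /andP[] := (stripP dk cubical _).1 zS i di; rewrite aE => s0 s1.
suff -> : Num.floor a = - n by rewrite mulrNz opprK.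
by apply: floor_def; rewrite intrD mulrNz; lra.
Qed.

(** With a zero star coordinate, an arbitrarily small move in direction [- e_i] would leave the
    strip, so the lattice point would lie on its boundary. *)
Lemma regular_star_gt0 z i : regular c -> (d <= i)%N -> cp_index c z ->
  0 < star (z + s) i.
Proof.
move=> reg di [zZ zS]; have /andP[s0 s1] := (stripP dk cubical _).1 zS i di.
rewrite lt_neqAle s0 andbT; apply/eqP => z0.
suff : (shifted_lattice c `&` boundary (strip c)) (z + s) by rewrite reg.
split; first by exists z.
split; first exact: subset_closure.
move=> /nbhs_ballP[e /= e0 ball_strip].
pose y := z + s - (e / 2) *: delta_mx 0 i.
suff /ball_strip H : ball (z + s) e y.
  have := (stripP dk cubical _).1 H i di.
  by rewrite starB starZ (star_delta dk)// eqxx mulr1 -z0; lra.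
split=> // l j; rewrite /ball /= !mxE subKr normrM.
rewrite gtr0_norm ?divr_gt0// (@le_lt_trans _ _ (e / 2))//; last by lra.
apply: ler_piMr; first by rewrite divr_ge0// ltW.
by case: (_ && _); rewrite ?normr1 ?normr0.
Qed.

End Density.

(** * Linear repetitivity *)

Section Return.
Variables (R : realType) (k d : nat).
Hypothesis dk : (d.+1 <= k)%N.
Variable c : cp_data R k d.+1.
Hypothesis cubical : cubical_window c.
Local Notation V := 'rV[R]_k.
Local Notation s := (cp_shift c).
Local Notation star := (star c).
Local Notation pi := (cp_pi c).

(* [z + s] and [pi (z + s)] differ by an element of the window, minus its image
   under [pi]. *)
Lemma cp_index_bound : exists2 K : R, 0 <= K &
  forall (z : V) (b : 'rV[R]_d.+1) (j : 'I_d.+1), cp_index c z ->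
    pi (z + s) = cp_rho c (embed k b) ->
    `|z 0 (widen_ord dk j)| <= `|b 0 j| + K.
Proof.
(* [K1] bounds the coordinates of [pi w] for [w] in the unit cube, and [K2] those of the shift. *)
pose K1 := \sum_j \sum_i `|pi (delta_mx 0 i) 0 j|; pose K2 := \sum_j `|s 0 j|.
have K10 : 0 <= K1 by rewrite sumr_ge0// => j _; rewrite sumr_ge0.
have K20 : 0 <= K2 by rewrite sumr_ge0.
exists (K1 + K2); first exact: addr_ge0.
move=> z b j [zZ zS] zb; set j' := widen_ord dk j.
set w := z + s - cp_rho c (z + s).
have w01 i : 0 <= w 0 i < 1.
  have [[l ->]|di] := ord_ltnP dk i; last exact: (stripP dk cubical _).1 zS i di.
  by have := star_widen dk c (z + s) l; rewrite /star -/w => ->; rewrite lexx ltr01.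
have piE : pi (cp_rho c (z + s)) = cp_rho c (z + s).
  by apply: daddv_pi_id; [case: (cp_compl_pi c)|exact: memv_pi].
have zsE : z + s = w + pi (z + s) - pi w.
  have -> : pi w = pi (z + s) - cp_rho c (z + s).
    by rewrite -[X in _ - X]piE /cp_pi -linearB.
  by apply/rowP => l; rewrite /w !mxE; ring.
have wj : w 0 j' = 0 by exact: (star_widen dk c (z + s) j).
clearbody w; have zjE : z 0 j' = b 0 j - pi w 0 j' - s 0 j'.
  have := congr1 (fun v : V => v 0 j') zsE; rewrite /= !mxE wj add0r zb.
  have := congr1 (fun v : 'rV[R]_d.+1 => v 0 j) (vhead_rho dk c (embed k b)).
  by rewrite vhead_embed mxE => ->; lra.
have piw : `|pi w 0 j'| <= K1.
  rewrite (row_sum_delta w) /cp_pi linear_sum summxE.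
  apply: le_trans (ler_norm_sum _ _ _) _.
  apply: (@le_trans _ _ (\sum_i `|pi (delta_mx 0 i) 0 j'|)).
    apply: ler_sum => i _; rewrite linearZ /= mxE normrM ler_piMl//.
    by have /andP[? ?] := w01 i; rewrite ger0_norm// ltW.
  rewrite /K1 [leRHS](bigD1 j')//= lerDl sumr_ge0// => l _.
  exact: sumr_ge0.
have sj : `|s 0 j'| <= K2 by rewrite /K2 (bigD1 j')//= lerDl sumr_ge0.
rewrite zjE; apply: le_trans (ler_normB _ _) _.
have := ler_normB (b 0 j) (pi w 0 j'); lra.
Qed.

(** The form in which linear repetitivity is used: applied to balls around 0, it brings every
    pattern back to a label whose head is bounded linearly in the volume of the shape. *)
Lemma LR_return : is_LR c (@lattice_polytopes R d.+1) ->
  exists K0 K1 : R, [/\ 0 <= K0, 0 <= K1 &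
    forall (B : 'M[R]_d.+1) (v : R) (z' : V),
      B \in unitmx -> B \is a mxOver Num.int -> (vol (simplex B) <= v%:E)%E ->
      cp_index c z' ->
      exists2 z, cp_index c z &
        patch_equiv c (simplex B) (pi (z' + s)) (pi (z + s)) /\
        forall j : 'I_d.+1, `|z 0 (widen_ord dk j)| <= K0 + K1 * v].
Proof.
move=> [C C0 LR]; have [K K_ge0 KP] := cp_index_bound.
exists (K + d.+1%:R), (d.+1%:R * C); split; [exact: addr_ge0|by rewrite mulr_ge0// ltW|].
move=> B v z' uB Bint Bv Iz'.
have B0 := vol_simplex_gt0 uB.
have [a aE] : exists a, vol (simplex B) = a%:E.
  exists (fine (vol (simplex B))); rewrite fineK// ge0_fin_numE ?vol_ge0//.
  exact: le_lt_trans Bv (ltry _).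
move: B0 Bv; rewrite aE lte_fin lee_fin => a0 av.
have [r /andP[r0 rC] rE] := vol_eball_surj d (mulr_gt0 C0 a0).
pose p := [set y | cp_set c y /\ patch_equiv c (simplex B) (pi (z' + s)) y].
have pP : is_pattern c (simplex B) p.
  by exists (pi (z' + s)) => //; apply/(cp_setP c); exists z'.
have rE' : vol (@eball R d.+1 0 r) = (C%:E * vol (simplex B))%E.
  by rewrite rE aE EFinM.
have [y] := LR _ (simplex_lattice_polytope uB Bint) p pP 0 r r0 rE'.
move=> [/cp_setP[z Iz ->] [_ [b br <-] zb]] [_ eqz].
exists z => //; split=> // j.
apply: le_trans (KP z b j Iz (esym zb)) _.
have bj : `|b 0 j| <= r.
  move: br; rewrite eball0E//= /qball /= => br.
  rewrite -[leRHS]ger0_norm ?(ltW r0)// -ler_sqr ?nnegrE// !real_normK ?num_real//.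
  apply: le_trans (ltW br); rewrite (bigD1 j)//= lerDl sumr_ge0// => i _.
  exact: sqr_ge0.
have Cav : d.+1%:R * (C * a + 1) <= d.+1%:R * C * v + d.+1%:R.
  by rewrite mulrDr mulr1 lerD2r -mulrA ler_pM2l// ler_pM2l.
by move: bj rC Cav; lra.
Qed.

End Return.

(** * Bounded heads, and the case of dimension at least two *)

Section NoLR.
Variables (R : realType) (k d : nat).
Hypothesis dk : (d.+1 <= k)%N.
Variable c : cp_data R k d.+1.
Hypotheses (cubical : cubical_window c) (dense_E : totally_irrational c).
Hypothesis LR : is_LR c (@lattice_polytopes R d.+1).
Local Notation V := 'rV[R]_k.
Local Notation s := (cp_shift c).
Local Notation star := (star c).
Local Notation pi := (cp_pi c).

(** Adding [M] encodes the integers of [-M, M] in a finite type, for taking minima and for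
    counting. *)
Definition head_code (M : nat) (z : V) (j : 'I_d.+1) : 'I_(2 * M).+1 :=
  inord `|Num.floor (z 0 (widen_ord dk j)) + M%:Z|.

Definition head_decode (M : nat) (n : 'I_(2 * M).+1) : R := n%:R - M%:R.

Lemma head_codeK M (z : V) (j : 'I_d.+1) : Zlat z -> `|z 0 (widen_ord dk j)| <= M%:R ->
  head_decode (head_code M z j) = z 0 (widen_ord dk j).
Proof.
move=> /mxOverP/(_ 0 (widen_ord dk j))/intrP[n nE]; rewrite /head_code /head_decode nE.
rewrite -intr_norm [M%:R]pmulrn ler_int => nM; rewrite intrKfloor inordK; last by lia.
rewrite [_%:R]pmulrn [(Posz `|_|)](_ : _ = n + M); last by lia.
by rewrite intrD addrK.
Qed.

(** The star coordinate is a function of the head, and only finitely many heads are bounded by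
    [M]. *)
Lemma star_lower_bound (M : nat) (i : 'I_k) : regular c -> (d.+1 <= i)%N ->
  exists2 e : R, 0 < e & forall z : V, cp_index c z ->
    (forall j, `|z 0 (widen_ord dk j)| <= M%:R) -> e <= star (z + s) i.
Proof.
move=> reg di.
pose a (h : {ffun 'I_d.+1 -> 'I_(2 * M).+1}) : R :=
  star (embed k (\row_j head_decode (h j)) + s) i.
(* The default 1 keeps [f] positive everywhere; it is not taken at the head of a point of the set,
   by regularity. *)
pose f h := if a h - (Num.floor (a h))%:~R <= 0 then 1 else a h - (Num.floor (a h))%:~R.
have [h|e e0 eP] := @exists_pos_lower_bound R _ f.
  by rewrite /f; case: ifPn; rewrite ?ltr01// -ltNge.
exists e => // z Iz zM; have := regular_star_gt0 dk cubical reg di Iz.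
have := eP [ffun j => head_code M z j]; rewrite (star_frac dk cubical di Iz) /f.
rewrite (_ : a _ = star (embed k (vhead dk z) + s) i); first by case: leP => //; lra.
rewrite /a; congr (star (embed k _ + s) i); apply/rowP => j.
by rewrite !mxE ffunE head_codeK//; case: Iz.
Qed.

Lemma no_LR_higher (i : 'I_k) : regular c -> (d.+1 <= i)%N -> (0 < d)%N -> False.
Proof.
move=> reg di d0.
have [K0 [K1 [K00 K10 ret]]] := LR_return dk cubical LR.
(* As 6 bounds the volume of every sheared simplex, [M] and then [e] are fixed before the shear is
   chosen. *)
pose M := (Num.truncn (K0 + K1 * 6)).+1.
have KM : K0 + K1 * 6 <= M%:R.
  have K6 : 0 <= K0 + K1 * 6 by rewrite addr_ge0// mulr_ge0.
  by have /andP[_ /ltW] := truncn_itv K6.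
have [e e0 eP] := star_lower_bound M reg di.
have [p irr] := exists_irrational_coef dk dense_E di.
have [q qp] : exists q : 'I_d.+1, q != p.
  have [->|p0] := eqVneq p ord0; last by exists ord0; rewrite eq_sym.
  by exists ord_max; rewrite -val_eqE /= -lt0n.
set al := star _ i in irr; pose be := star (delta_mx 0 (widen_ord dk q)) i.
have [n [a /andP[th0 the]]] := irrational_dense (- be) irr e0.
set th := _ + _ in th0 the.
(* The vertex [m] is e_q - a e_p, so [th] plus its star coordinate is the integer [n]: this vertex
   detects the threshold [th]. *)
pose B : 'M[R]_d.+1 := shear R q p (- a); pose m := row q B.
have starm : star (embed k m) i = be - a%:~R * al.
  have -> : embed k m = delta_mx 0 (widen_ord dk q) - a%:~R *: delta_mx 0 (widen_ord dk p).
    apply/rowP => j; have [[l ->]|dj] := ord_ltnP dk j.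
      have wE x : (widen_ord dk l == widen_ord dk x) = (l == x) by [].
      by rewrite embed_widen !mxE !wE !eqxx /= mulrNz mulNr [q == l]eq_sym.
    have wE x : (j == widen_ord dk x) = false.
      by apply/negP => /eqP jx; move: dj; rewrite jx /= leqNgt ltn_ord.
    by rewrite embed_ge// !mxE !wE !andbF mulr0 subr0.
  by rewrite starB starZ.
(* The minimum with 1 keeps the cell inside the window when [th] exceeds 1. *)
have th1 : Num.min th 1 <= 1 by rewrite ge_min lexx orbT.
have thp : 0 < Num.min th 1 by rewrite lt_min th0 ltr01.
have [z' Iz' z'P] := cp_index_dense dk cubical dense_E (fun=> lexx 0)
  (fun=> th1) (fun=> thp).
have uB := shear_unit R (- a) qp.
have [z Iz [eqz zM]] := ret B 6 z' uB (shear_int _ _ _ _) (vol_simplex_shear R (- a) qp) Iz'.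
have : star (z' + s) i < th by have /andP[_] := z'P i di; rewrite lt_min => /andP[].
(* The bound by [th] passes from [z'] to the returned point [z], whose star coordinate is at least
   [e > th]. *)
rewrite (patch_equiv_cell dk cubical Iz' Iz eqz (m := m) _ _ di).
- have := eP z Iz (fun j => le_trans (zM j) KM); lra.
- by apply/mxOverP => l j; rewrite mxE; apply/mxOverP; exact: shear_int.
- exact: simplex_row.
- by rewrite starm (_ : _ + _ = n%:~R) ?intr_int// /th; ring.
Qed.

End NoLR.

(** The right end of the cell that starts at [a]: the next value of [u], or 1 if there is none. *)
Lemma exists_gap (R : realType) (N : nat) (u : 'I_N -> R) (a : R) : a < 1 ->
  exists b, [/\ a < b, b <= 1 & forall t, a < u t -> b <= u t].
Proof.
move=> a1; exists (\big[Num.min/1]_(t | a < u t) u t); split.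
- exact: lt_bigmin.
- exact: bigmin_le_id.
- by move=> t; exact: bigmin_le_cond.
Qed.

Lemma vol_simplex_scalar1 (R : realType) (N : nat) : (0 < N)%N ->
  (vol (simplex (N%:R%:M : 'M[R]_1)) <= N%:R%:E)%E.
Proof.
move=> N0; have -> : N%:R%:E = vol (box (0 : 'rV[R]_1) (const_mx N%:R)).
  by rewrite vol_box => [|i]; rewrite ?big_ord1 !mxE ?subr0.
apply: le_vol; [exact: vol_measurable_simplex|exact: vol_measurable_box|].
by move=> x /(simplex_scalar1 _ N0) x0N i; rewrite (ord1 i) !mxE.
Qed.

(** * The case of dimension one *)

Section Line.
Variables (R : realType) (k : nat).
Hypothesis dk : (1 <= k)%N.
Variable c : cp_data R k 1.
Hypotheses (cubical : cubical_window c) (dense_E : totally_irrational c).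
Hypothesis LR : is_LR c (@lattice_polytopes R 1).
Local Notation s := (cp_shift c).
Local Notation star := (star c).
Implicit Types (i : 'I_k).

Definition slope i : R := star (delta_mx 0 (widen_ord dk ord0)) i.

(** The fractional part of [- (t * slope i)]: the threshold that the lattice point [t] of the
    segment imposes on star coordinate [i]. *)
Definition cut i (t : nat) : R :=
  - (t%:R * slope i) - (Num.floor (- (t%:R * slope i)))%:~R.

Lemma cut_itv i t : 0 <= cut i t < 1.
Proof.
have := floor_itv (- (t%:R * slope i)); rewrite intrD /cut.
by move=> /andP[? ?]; apply/andP; split; lra.
Qed.

(** In dimension one the irrational coefficient can only be [slope i], and two equal cuts would make
    a positive multiple of it an integer. *)
Lemma cut_inj i : (1 <= i)%N -> injective (cut i).
Proof.
move=> di t t'; have [p] := exists_irrational_coef dk dense_E di.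
rewrite (ord1 p) -/(slope i) => irr.
wlog tt' : t t' / (t <= t')%N.
  by move=> H; case/orP: (leq_total t t') => [/H|/H H' /esym /H'].
rewrite /cut => E; apply/eqP; rewrite eqn_leq tt' leqNgt; apply/negP => lt_tt'.
have /negP[] := irr (t' - t)%N (ltac:(by rewrite subn_gt0)).
rewrite natrB// mulrBl (_ : _ - _ = (Num.floor (- (t%:R * slope i)) -
  Num.floor (- (t'%:R * slope i)))%:~R) ?intr_int//.
by rewrite intrD mulrNz; lra.
Qed.

Lemma star_embed_const i (t : nat) :
  star (embed k (const_mx t%:R : 'rV[R]_1)) i = t%:R * slope i.
Proof.
rewrite /slope -starZ; congr (star _ i); apply/rowP => j.
have [[l ->]|dj] := ord_ltnP dk j.
  by rewrite embed_widen !mxE (ord1 l) !eqxx mulr1.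
rewrite embed_ge// !mxE (_ : (j == _) = false) ?andbF ?mulr0//.
by apply/negP => /eqP jx; move: dj; rewrite jx.
Qed.

(** By density some point lies in the product of the gaps that start at the two chosen cuts. Its
    pattern returns near 0, and equivalence of patches preserves all comparisons with cuts. *)
Lemma cell_in_ball (N M : nat) i1 i2 (j1 j2 : 'I_N) :
  (1 <= i1)%N -> (1 <= i2)%N -> i1 != i2 ->
  (forall z', cp_index c z' -> exists2 z, cp_index c z &
    patch_equiv c (simplex (N%:R%:M : 'M[R]_1)) (cp_pi c (z' + s)) (cp_pi c (z + s)) /\
    forall j : 'I_1, `|z 0 (widen_ord dk j)| <= M%:R) ->
  exists z, [/\ cp_index c z, `|z 0 (widen_ord dk ord0)| <= M%:R,
    forall t : 'I_N, (star (z + s) i1 < cut i1 t) = (cut i1 j1 < cut i1 t) &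
    forall t : 'I_N, (star (z + s) i2 < cut i2 t) = (cut i2 j2 < cut i2 t)].
Proof.
move=> di1 di2 i12 ret.
have N0 : (0 < N)%N by apply: leq_trans (ltn_ord j1).
have lt1 i t : cut i t < 1 by have /andP[] := cut_itv i t.
have [b1 [ab1 b11 b1P]] := exists_gap (fun t : 'I_N => cut i1 t) (lt1 i1 j1).
have [b2 [ab2 b21 b2P]] := exists_gap (fun t : 'I_N => cut i2 t) (lt1 i2 j2).
pose a i := if i == i1 then cut i1 j1 else if i == i2 then cut i2 j2 else 0.
pose b i := if i == i1 then b1 else if i == i2 then b2 else 1.
have a0 i : 0 <= a i.
  have /andP[c1 _] := cut_itv i1 j1; have /andP[c2 _] := cut_itv i2 j2.
  by rewrite /a; do 2 case: ifP => _ //.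
have le_b1 i : b i <= 1 by rewrite /b; do 2 case: ifP => _ //.
have ab i : a i < b i by rewrite /a /b; do 2 case: ifP => _ //.
have [z' Iz' z'P] := cp_index_dense dk cubical dense_E a0 le_b1 ab.
have [z Iz [eqz zM]] := ret z' Iz'.
have cell i (t : 'I_N) : (1 <= i)%N ->
    (star (z + s) i < cut i t) = (star (z' + s) i < cut i t).
  move=> di; rewrite (patch_equiv_cell dk cubical Iz' Iz eqz
    (m := const_mx t%:R : 'rV[R]_1) _ _ di)//.
  - by apply/mxOverP => l l'; rewrite mxE natr_int.
  - by apply/simplex_scalar1 => //; rewrite mxE ler0n ler_nat ltnW.
  - by rewrite star_embed_const /cut addrAC addNr add0r rpredN intr_int.
exists z; split=> // t; rewrite cell//.
  have := z'P i1 di1; rewrite /a /b eqxx => /andP[z1 z2].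
  apply/idP/idP => [|/b1P]; first exact: lt_trans.
  exact: lt_le_trans.
have := z'P i2 di2; rewrite /a /b eqxx [i2 == i1]eq_sym (negbTE i12) => /andP[z1 z2].
apply/idP/idP => [|/b2P]; first exact: lt_trans.
exact: lt_le_trans.
Qed.

Lemma no_LR_line i1 i2 : (1 <= i1)%N -> (1 <= i2)%N -> i1 != i2 -> False.
Proof.
move=> di1 di2 i12; have [K0 [K1 [K00 K10 ret]]] := LR_return dk cubical LR.
(* There are 2 M + 1 heads with M <= K0 + K1 N + 1, hence at most T N of them; N > T makes this less
   than the N ^ 2 cells. *)
pose T := 2 * K0 + 2 * K1 + 3; have T0 : 0 <= T by rewrite /T; lra.
have [N N0 TN] : exists2 N, (0 < N)%N & T < N%:R.
  by exists (Num.truncn T).+1 => //; have /andP[] := truncn_itv T0.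
have N1 : 1 <= N%:R :> R by rewrite ler1n.
have L0 : 0 <= K0 + K1 * N%:R by rewrite addr_ge0// mulr_ge0.
have [M M0 M1] : exists2 M : nat, M%:R <= K0 + K1 * N%:R + 1 & K0 + K1 * N%:R < M%:R.
  exists (Num.truncn (K0 + K1 * N%:R)).+1; have /andP[? ?] := truncn_itv L0 => //.
  by rewrite -natr1 lerD2r.
have uB : (N%:R%:M : 'M[R]_1) \in unitmx.
  by rewrite unitmxE det_scalar1 unitfE pnatr_eq0 -lt0n.
have intB : (N%:R%:M : 'M[R]_1) \is a mxOver Num.int.
  by apply/mxOverP => l l'; rewrite mxE (ord1 l) (ord1 l') eqxx mulr1n natr_int.
have /choice[f fP] (jl : 'I_N * 'I_N) : exists z, [/\ cp_index c z,
    `|z 0 (widen_ord dk ord0)| <= M%:R,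
    forall t : 'I_N, (star (z + s) i1 < cut i1 t) = (cut i1 jl.1 < cut i1 t) &
    forall t : 'I_N, (star (z + s) i2 < cut i2 t) = (cut i2 jl.2 < cut i2 t)].
  apply: cell_in_ball => // z' Iz'.
  have [z Iz [eqz zM]] := ret _ _ z' uB intB (vol_simplex_scalar1 R N0) Iz'.
  exists z => //; split=> // j; exact: le_trans (zM j) (ltW M1).
(* Equal heads give equal star coordinates, hence equal comparisons with all cuts, hence the same
   cell. *)
have f_inj : injective (fun jl => head_code dk M (f jl) ord0).
  move=> jl jl' ff'; have [Iz zM z1 z2] := fP jl; have [Iz' zM' z1' z2'] := fP jl'.
  have ff0 : f jl 0 (widen_ord dk ord0) = f jl' 0 (widen_ord dk ord0).
    by rewrite -(head_codeK Iz.1 zM) -(head_codeK Iz'.1 zM') ff'.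
  have sE i : (1 <= i)%N -> star (f jl + s) i = star (f jl' + s) i.
    move=> di; rewrite (star_frac dk cubical di Iz) (star_frac dk cubical di Iz').
    suff -> : vhead dk (f jl) = vhead dk (f jl') by [].
    by apply/rowP => l; rewrite !mxE (ord1 l).
  have cut_eq i (t t' : 'I_N) : (1 <= i)%N ->
      (forall t1 : 'I_N, (cut i t < cut i t1) = (cut i t' < cut i t1)) -> t = t'.
    move=> di H; apply: val_inj; apply: (cut_inj di) => /=.
    have := H t; have := H t'; rewrite !ltxx => /negbT + /esym/negbT.
    by rewrite -!leNgt => ? ?; apply/eqP; rewrite eq_le; apply/andP.
  case: jl jl' {ff' ff0 Iz zM Iz' zM'} z1 z2 z1' z2' sE =>
    [j l] [j' l'] /= z1 z2 z1' z2' sE.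
  congr pair; first by apply: (cut_eq i1) => // t; rewrite -z1 -z1' sE.
  by apply: (cut_eq i2) => // t; rewrite -z2 -z2' sE.
have := leq_card _ f_inj; rewrite card_prod !card_ord leqNgt => /negP; apply.
rewrite -(ltr_nat R) -natr1 !natrM -natr1.
have : T * N%:R < N%:R * N%:R by rewrite ltr_pM2r// (lt_le_trans ltr01).
have : K0 <= K0 * N%:R by rewrite ler_peMr.
rewrite /T; lra.
Qed.

End Line.

Theorem theorem1p1 (R : realType) (k d : nat) (hd : (1 <= d)%N)
    (hdk : (d < k)%N) (hkd : (k, d) <> (2, 1)%N) :
  ~ exists c : cp_data R k d,
      cubical_cp_set c /\ is_LR c (@lattice_polytopes R d).
Proof.
case: d hd hdk hkd => // d _ hdk hkd [c [[reg dense_E _ cubical] LR]].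
have [d0|d0] := posnP d; last first.
  exact: (no_LR_higher (ltnW hdk) cubical dense_E LR (i := Ordinal hdk)).
(* In dimension one the excluded pair (2, 1) leaves k >= 3, so the indices 1 and 2 give two star
   coordinates. *)
subst d; have k3 : (2 < k)%N by move: hdk hkd; case: k c reg dense_E cubical LR => [|[|[|?]]].
exact: (no_LR_line (ltnW hdk) cubical dense_E LR (i1 := Ordinal hdk) (i2 := Ordinal k3)).
Qed.
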